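(* Let $k\ge 1$ be an integer and let $\alpha,c,N$ be real numbers such that none of $\alpha+c-N+1$, $\alpha-N+1$, $\alpha+c$, $c-k-1$ belongs to $\{0,-1,-2,\dots\}$. Let $r_0=1$, $r_j(x)=(-1)^j\prod_{i=0}^{j-1}[x+i(\alpha+c-N-2-i)]$ for $j\ge 1$, and let $h^*_{2,k}$ be the dual Hahn polynomial $$h^*_{2,k}(x)=\sum_{j=0}^k\frac{(-k)_j(2-c+j)_{k-j}(N+1+j)_{k-j}}{j!}r_j(x).$$ Assume $h^*_{2,k}(n(n-2-N+\alpha+c))\neq 0$ for all $n\ge 0$. Define polynomials of degrees $k$ and $k+1$, respectively, by $$P_2(x)=h^*_{2,k}(x),$$ $$P_1(x)=(\alpha+c-N)h^*_{2,k}(x)+2(x-\alpha-c+N+1)\sum_{j=0}^k\frac{(-k)_j(2-c+j)_{k-j}(N+1+j)_{k-j}}{(j+1)!}r_j(x).$$ Put $\theta_n=(n+1)(n+\alpha+c-N-1)$, $\sigma_n=2n+\alpha+c-N-2$, and define $$\gamma_n=h^*_{2,k}(n(n-2-N+\alpha+c)),\qquad \beta_n=\frac{n(n+\alpha-N)(n+\alpha+c-1)}{(2n+\alpha+c-N-1)(2n+\alpha+c-N-2)}\frac{\gamma_{n+1}}{\gamma_n}\quad(n\ge 1),$$ $$\lambda_n=\frac{\sigma_n\gamma_n+P_1(\theta_{n-1})}{2}\ (n\ge 1),\qquad \lambda_0=\frac{P_1(\theta_0)-\sigma_1P_2(\theta_0)}{2},$$ and $q_0=1$, $q_n(x)=h_n^{\alpha,c,N}(x)+\beta_nh_{n-1}^{\alpha,c,N}(x)$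 for $n\ge 1$, where $(h_n^{\alpha,c,N})_n$ are the Hahn polynomials. Let $$\tilde\rho=(x+1)\cdots(x+k)\,\rho_{\alpha+k+1,c-k-1,N+k+1}(x+k+1),$$ where $\rho_{\alpha+k+1,c-k-1,N+k+1}$ is the Hahn moment functional with parameters $\alpha+k+1,c-k-1,N+k+1$. If $N$ is not a positive integer, then the polynomials $(q_n)_n$ are orthogonal with respect to the moment functional $\tilde\rho$. If $N$ is a positive integer, then the polynomials $(q_n)_{0\le n\le N}$ are orthogonal with respect to the measure $$\tilde\rho=(-1)^kk!\,\Gamma(\alpha+k+1)\Gamma(c-k-1)\,\delta_{-k-1}+\Gamma(N+k+1)\sum_{x=0}^{N-1}\frac{\Gamma(\alpha-x)\Gamma(x+c)}{(x+k+1)\Gamma(N-x)x!}\,\delta_x.$$ Moreover, for the difference operator of order $2k+2$ and genre $(-k-1,k+1)$ $$D=\tfrac12P_1(D_{\alpha,c,N})-\Big(\tfrac{\alpha+c-N}{2}I+(x-\alpha)\nabla\Big)P_2(D_{\alpha,c,N}),$$ where $D_{\alpha,c,N}$ is the second order Hahn difference operator, one has $D(q_n)=\lambda_nq_n$.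
   Context: For $l\in\mathbb{Z}$ the shift operator $\mathfrak{s}_l$ acts on polynomials by $\mathfrak{s}_l(f)(x)=f(x+l)$; $\nabla f(x)=f(x)-f(x-1)$, $I$ is the identity. A finite difference operator $\sum_{l=s}^r f_l\,\mathfrak{s}_l$ (with polynomial coefficients $f_l$) with $f_s,f_r\neq 0$ has order $r-s$ and genre $(s,r)$. For a linear operator $T$ and a polynomial $P(x)=\sum_j a_jx^j$, $P(T)=\sum_j a_jT^j$; products of operators are compositions. $(y)_j=y(y+1)\cdots(y+j-1)$, $(y)_0=1$. Monic Hahn polynomials ($\alpha+c-N\neq -1,-2,\dots$): $h_n^{\alpha,c,N}(x)=\sum_{j=0}^n\frac{(-n)_j(-x)_j(1-N+j)_{n-j}(c+j)_{n-j}}{(n+\alpha+c-N+j)_{n-j}\,j!}$. Hahn operator: $$D_{\alpha,c,N}=x(x-\alpha)\mathfrak{s}_{-1}+[-2x^2+(\alpha-c+N-1)x+\alpha+N(c-1)-1]\mathfrak{s}_0+(x+c)(x-N+1)\mathfrak{s}_1,$$ $D_{\alpha,c,N}(h_n^{\alpha,c,N})=(n+1)(n+\alpha+c-N-1)h_n^{\alpha,c,N}$. A moment functional is a linear map $\mu:\mathbb{P}\to\mathbb{R}$ on the space $\mathbb{P}$ of real polynomials; for a polynomial $r$, $\langle r\mu,p\rangle=\langle\mu,rp\rangle$, and for a real number $t$, $\langle\mu(x+t),p\rangle=\langle\mu,p(x-t)\rangle$. Hahn moment functional $\rho_{\alpha,c,N}$: if $N$ is not a positive integer and none of $\alpha+c-N+1,\alpha-N+1,\alpha+c,c$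 is in $\{0,-1,-2,\dots\}$, it is the moment functional with respect to which $(h_n^{\alpha,c,N})_n$ are orthogonal, normalized by $\langle\rho_{\alpha,c,N},1\rangle=\frac{\Gamma(\alpha+1-N)\Gamma(c)\Gamma(\alpha+c)}{\Gamma(\alpha+c+1-N)}$; if $N$ is a positive integer, it is the measure $\rho_{\alpha,c,N}=\Gamma(N)\sum_{x=0}^{N-1}\frac{\Gamma(\alpha-x)\Gamma(x+c)}{\Gamma(N-x)x!}\delta_x$. Polynomials $(q_n)_n$ (finitely or infinitely many) with $\deg q_n=n$ are orthogonal with respect to $\mu$ if $\langle\mu,q_nx^m\rangle=0$ for $0\le m<n$ and $\langle\mu,q_nx^n\rangle\neq 0$.
   Formalization: It is also assumed that α+c−N≠0 (else β_1 is undefined) and, for orthogonality when N is not a positive integer, that N≠0 (else ρ̃ is one point mass and the claim fails) and α+c−N∉{1,…,k} (else the shifted Hahn functional is not defined). *)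

(* Defs.v *)
From HB Require Import structures.
From mathcomp Require Import all_boot all_order all_algebra.
From mathcomp Require Import all_classical all_reals all_analysis.
Import Order.TTheory GRing.Theory Num.Theory.
Import numFieldNormedType.Exports.

Set Implicit Arguments.
Unset Strict Implicit.
Unset Printing Implicit Defensive.

Local Open Scope classical_set_scope.
Local Open Scope ring_scope.

Definition posint {R : realType} (z : R) : bool := (z \is a Num.nat) && (0 < z).

(* z belongs to {0, -1, -2, ...} *)
Definition nonposint {R : realType} (z : R) : bool := - z \is a Num.nat.

(* (y)_j = y (y + 1) ... (y + j - 1); also used with y a polynomial. *)
Definition poch {A : nzRingType} (y : A) (j : nat) : A :=
  \prod_(i < j) (y + i%:R).

(* Euler's integral, continued to x <= 0 by Gamma x = Gamma (x + m) / (x)_m,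
   where m is the least natural number such that 0 < x + m.  (At the poles the
   value is 0, by the convention y / 0 = 0.) *)
Definition Gamma {R : realType} (x : R) : R :=
  let m := Num.truncn (1 - x) in
  (\int[lebesgue_measure]_(t in `]0%R, +oo[) (t `^ (x + m%:R - 1) * expR (- t)))
    / poch x m.

(** Difference operators *)

Definition shift_op {R : realType} (l : int) (f : {poly R}) : {poly R} :=
  f \Po ('X + (l%:~R)%:P).

Definition nabla {R : realType} (f : {poly R}) : {poly R} :=
  f - shift_op (-1) f.

(* P(T) = \sum_j a_j T^j, the powers of T being iterated compositions. *)
Definition op_poly {R : realType} (P : {poly R}) (T : {poly R} -> {poly R})
    (f : {poly R}) : {poly R} :=
  \sum_(j < size P) P`_j *: iter j T f.

Definition diff_op_order_genre {R : realType} (D : {poly R} -> {poly R})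
    (d : nat) (s r : int) : Prop :=
  r - s = d%:Z /\
  exists f : int -> {poly R},
    [/\ f s != 0, f r != 0 &
      forall p, D p = \sum_(i < d.+1) f (s + i%:Z) * shift_op (s + i%:Z) p].

(** Moment functionals *)

Definition polymul_functional {R : realType} (r : {poly R})
    (mu : {poly R} -> R) : {poly R} -> R := fun p => mu (r * p).

(* mu(x + t) *)
Definition shift_functional {R : realType} (mu : {poly R} -> R) (t : R)
    : {poly R} -> R := fun p => mu (p \Po ('X - t%:P)).

(* I is the set of indices of the family: all of nat, or an initial segment. *)
Definition orthogonal_polys {R : realType} (mu : {poly R} -> R)
    (I : pred nat) (q : nat -> {poly R}) : Prop :=
  forall n, I n ->
    [/\ size (q n) = n.+1,
        forall m, (m < n)%N -> mu (q n * 'X^m) = 0 &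
        mu (q n * 'X^n) != 0].

(** Hahn polynomials, operator and functional *)

Definition hahn {R : realType} (al c N : R) (n : nat) : {poly R} :=
  \sum_(j < n.+1)
    (poch (- n%:R) j * poch (1 - N + j%:R) (n - j) * poch (c + j%:R) (n - j)
      / (poch (n%:R + al + c - N + j%:R) (n - j) * j`!%:R))
    *: poch (- 'X) j.

Definition hahn_op {R : realType} (al c N : R) (f : {poly R}) : {poly R} :=
  'X * ('X - al%:P) * shift_op (-1) f
  + (- 2 *: 'X^2 + (al - c + N - 1) *: 'X + (al + N * (c - 1) - 1)%:P) * f
  + ('X + c%:P) * ('X - (N - 1)%:P) * shift_op 1 f.

(* The conditions under which the functional is determined by orthogonality. *)
Definition hahn_generic {R : realType} (al c N : R) : bool :=
  [&& ~~ posint N, ~~ nonposint (al + c - N + 1), ~~ nonposint (al - N + 1),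
      ~~ nonposint (al + c) & ~~ nonposint c].

Definition hahn_mass {R : realType} (al c N : R) : R :=
  Gamma (al + 1 - N) * Gamma c * Gamma (al + c) / Gamma (al + c + 1 - N).

(* The measure if N is a positive integer; otherwise the normalized linear
   functional making the Hahn polynomials orthogonal (and the null functional
   if there is none). *)
Definition hahn_functional {R : realType} (al c N : R) : {poly R} -> R :=
  if posint N then
    fun p => Gamma N * \sum_(x < Num.truncn N)
      Gamma (al - x%:R) * Gamma (x%:R + c) / (Gamma (N - x%:R) * x`!%:R)
        * p.[x%:R]
  else
    xget (fun=> 0) [set mu : {poly R} -> R |
      [/\ scalar mu, orthogonal_polys mu xpredT (hahn al c N) &
          mu 1 = hahn_mass al c N]].

(** The dual Hahn polynomial and the data it generates *)

Definition dual_basis {R : realType} (al c N : R) (j : nat) : {poly R} :=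
  (-1) ^+ j *: \prod_(i < j) ('X + (i%:R * (al + c - N - 2 - i%:R))%:P).

Definition dual_coef {R : realType} (c N : R) (k j : nat) : R :=
  poch (- k%:R) j * poch (2 - c + j%:R) (k - j) * poch (N + 1 + j%:R) (k - j).

(* h^*_{2,k} *)
Definition dual_hahn2 {R : realType} (al c N : R) (k : nat) : {poly R} :=
  \sum_(j < k.+1) (dual_coef c N k j / j`!%:R) *: dual_basis al c N j.

Definition P2 {R : realType} (al c N : R) (k : nat) : {poly R} :=
  dual_hahn2 al c N k.

Definition P1 {R : realType} (al c N : R) (k : nat) : {poly R} :=
  (al + c - N) *: dual_hahn2 al c N k
  + 2 *: (('X - (al + c - N - 1)%:P) *
      \sum_(j < k.+1) (dual_coef c N k j / (j.+1)`!%:R) *: dual_basis al c N j).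

Definition theta {R : realType} (al c N : R) (n : nat) : R :=
  (n%:R + 1) * (n%:R + al + c - N - 1).

Definition sigma {R : realType} (al c N : R) (n : nat) : R :=
  2 * n%:R + al + c - N - 2.

Definition gamma {R : realType} (al c N : R) (k n : nat) : R :=
  (dual_hahn2 al c N k).[n%:R * (n%:R - 2 - N + al + c)].

Definition beta {R : realType} (al c N : R) (k n : nat) : R :=
  n%:R * (n%:R + al - N) * (n%:R + al + c - 1)
    / ((2 * n%:R + al + c - N - 1) * (2 * n%:R + al + c - N - 2))
  * (gamma al c N k n.+1 / gamma al c N k n).

Definition lambda {R : realType} (al c N : R) (k n : nat) : R :=
  if n is m.+1 then
    (sigma al c N n * gamma al c N k n + (P1 al c N k).[theta al c N m]) / 2
  else
    ((P1 al c N k).[theta al c N 0]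
      - sigma al c N 1 * (P2 al c N k).[theta al c N 0]) / 2.

Definition q {R : realType} (al c N : R) (k n : nat) : {poly R} :=
  if n is m.+1 then hahn al c N n + beta al c N k n *: hahn al c N m else 1.

(* (x + 1) ... (x + k) rho_{al+k+1, c-k-1, N+k+1}(x + k + 1) *)
Definition rho_tilde {R : realType} (al c N : R) (k : nat) : {poly R} -> R :=
  polymul_functional (\prod_(1 <= i < k.+1) ('X + i%:R%:P))
    (shift_functional
      (hahn_functional (al + k%:R + 1) (c - k%:R - 1) (N + k%:R + 1))
      (k%:R + 1)).

Definition krall_op {R : realType} (al c N : R) (k : nat) (f : {poly R})
    : {poly R} :=
  let g := op_poly (P2 al c N k) (hahn_op al c N) f in
  2^-1 *: op_poly (P1 al c N k) (hahn_op al c N) f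
  - (((al + c - N) / 2) *: g + ('X - al%:P) * nabla g).

(* Main.v *)
Require Import Defs.
From HB Require Import structures.
From mathcomp Require Import all_boot all_order all_algebra.
From mathcomp Require Import all_classical all_reals all_analysis.
From mathcomp Require Import measurable_realfun.
From mathcomp Require Import ring lra zify.
Import Order.TTheory GRing.Theory Num.Theory.
Import numFieldNormedType.Exports.

Set Implicit Arguments.
Unset Strict Implicit.
Unset Printing Implicit Defensive.

Local Open Scope classical_set_scope.
Local Open Scope ring_scope.

(** Write u = al + c - N, h_n for the monic Hahn polynomials and
    eps_n = n(n+al-N)(n+al+c-1) / ((2n+u-1)(2n+u-2)), which is ladder_coef, so
    that beta_n = eps_n gamma_(n+1) / gamma_n.

    The difference operator.  As h_n is an eigenfunction of hahn_op for theta_n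
    and P2(theta_n) = gamma_(n+1), the choice of beta_n gives
    P2(hahn_op) q_n = gamma_(n+1) (h_n + eps_n h_(n-1)).  On this particular
    combination (x - al) nabla acts separately on the two terms: it is
    n h_n - (n+u-1) eps_n h_(n-1) (hahn_ladder).  Indeed (x - al) nabla is
    diagonal in the basis (al - x)_j, and the coefficients of h_n in that basis
    are known in closed form, because the reflection x -> x - al maps Hahn
    polynomials to Hahn polynomials (hahn_reflection).  What is left of
    D q_n = lambda_n q_n is a scalar identity for the differences of P1 at
    consecutive theta_n (P1_recur), which holds term by term.

    Orthogonality.  Everything is drawn from the Pearson equation
    L(x(x-al) p(x-1)) = L((x+c)(x-N+1) p(x)).  The functional with generic
    parameters and the measure on the first N natural numbers both satisfy it,
    so the two cases of the theorem have the same proof.  The equation makes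
    hahn_op symmetric, whence the orthogonality of the h_n (hahn_orth); the
    norms are non-zero because differencing h_n gives a Hahn polynomial of
    degree n - 1 for a functional of the same kind (hahn_norm_neq0).

    Let nu be the shifted functional and rho~ = (x+1)...(x+k) nu.  Multiplying
    once more by x + k + 1 gives a functional rho that satisfies the Pearson
    equation for (al, c, N).  Thus rho~ is a Geronimus transform of rho, and
    q_n = h_n + beta_n h_(n-1) is automatically orthogonal to every multiple of
    x + k + 1 of degree less than n; only rho~(q_n) = 0 has to be shown
    (q_mass).  For this, let chain_s = (x+s+1)...(x+k+1) nu.  It satisfies a
    Pearson equation with x replaced by x + s, and together with the eigenvalue
    equation this yields
      j (c-1-j) (N+j) chain_(j+1)(h_n) = (n+j) (n+u-j) chain_j(h_n)
    (hahn_value_step).  The right-hand factor is, up to sign, the ratio of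
    consecutive elements of the basis of dual Hahn polynomials at theta_n.
    Since rho~ is a combination of chain_1, ..., chain_(k+1) (geronimus_chain),
    rho~(h_n) is chain_1(h_n) times a sum over j which is recognized as
    gamma_(n+1) / gamma_0 (geronimus_value).  Finally
    chain_1(h_n) = - eps_n chain_1(h_(n-1)) (hahn_value_ladder), and beta_n is
    the number that makes rho~(q_n) vanish. *)

(** * Pochhammer symbols *)

Section Pochhammer.
Context {A : nzRingType}.
Implicit Types (y : A) (j : nat).

Lemma poch0 y : poch y 0 = 1.
Proof. by rewrite /poch big_ord0. Qed.

Lemma pochSl y j : poch y j.+1 = y * poch (y + 1) j.
Proof.
rewrite /poch big_ord_recl addr0; congr (_ * _); apply: eq_bigr => i _.
by rewrite /= -addrA -natr1 (addrC 1).
Qed.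

Lemma pochS y j : poch y j.+1 = poch y j * (y + j%:R).
Proof. by rewrite /poch big_ord_recr. Qed.

End Pochhammer.

Lemma poch_neq0 {F : fieldType} (y : F) j :
  (forall i, (i < j)%N -> y + i%:R != 0) -> poch y j != 0.
Proof. by move=> h; apply/prodf_neq0 => i _; exact: h. Qed.

Lemma poch_rmorph (A B : nzRingType) (f : {rmorphism A -> B}) y j :
  f (poch y j) = poch (f y) j.
Proof.
by rewrite /poch rmorph_prod; apply: eq_bigr => i _; rewrite rmorphD rmorph_nat.
Qed.

Lemma poch_split (A : comNzRingType) (y : A) i m : (i <= m)%N ->
  poch y m = poch y i * poch (y + i%:R) (m - i).
Proof.
move=> im; rewrite -{1}(subnKC im) /poch big_split_ord /=; congr (_ * _).
by apply: eq_bigr => l _; rewrite natrD addrA.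
Qed.

(** The product is peeled from its first factor:
    (y+1)(y+2)_m = (y+2)_(m+1) - (m+1) (y+2)_m, and the induction hypothesis at
    y + 1 expands the last term.  The products on the right are the tails of one
    product with last factor y + m + 1, so that each is a multiple of the next. *)
Lemma poch_expand (A : comNzRingType) (y : A) m :
  poch (y + 1) m = \sum_(j < m.+1) poch (- m%:R) j * poch (y + j.+2%:R) (m - j).
Proof.
elim: m y => [|m IH] y; first by rewrite big_ord1 /= subnn !poch0 mulr1.
rewrite big_ord_recl /= poch0 mul1r subn0.
under eq_bigr => i _ do rewrite /bump /= add1n pochSl subSS -mulrA.
rewrite -mulr_sumr.
have := IH (y + 1).
under eq_bigr => i _ do rewrite -addrA (_ : 1 + i.+2%:R = i.+3%:R) ?(addrC 1) ?natr1//.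
rewrite (_ : - m.+1%:R + 1 = - m%:R); last by rewrite -natr1; ring.
move=> <-; rewrite pochSl pochS -addrA (_ : 1 + 1 = 2%:R)// -!natr1; ring.
Qed.

Section PochhammerReal.
Context {R : realType}.
Implicit Types (i j k n y : nat).

Lemma fact_neq0 j : j`!%:R != 0 :> R.
Proof. by rewrite pnatr_eq0 -lt0n fact_gt0. Qed.

Lemma poch_fact y k : (y + k)`!%:R = y`!%:R * poch (y%:R + 1) k :> R.
Proof.
elim: k => [|k IH]; first by rewrite addn0 poch0 mulr1.
by rewrite addnS factS natrM IH pochS -natr1 natrD; ring.
Qed.

Lemma horner_poch (p : {poly R}) j (x : R) : (poch p j).[x] = poch p.[x] j.
Proof. exact: (poch_rmorph (horner_eval x)). Qed.

Lemma poch_opp k : poch (- k%:R) k = (-1) ^+ k * k`!%:R :> R.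
Proof.
elim: k => [|i IH]; first by rewrite poch0 expr0 mulr1.
rewrite pochSl (_ : - i.+1%:R + 1 = - i%:R); last by rewrite -natr1; ring.
rewrite IH exprS factS natrM; ring.
Qed.

Lemma poch_opp0 i j : (i < j)%N -> poch (- i%:R) j = 0 :> R.
Proof.
move=> ij; rewrite /poch (bigD1 (Ordinal ij)) //= addNr mul0r //.
Qed.

Lemma poch_oppS n j : poch (- n.+1%:R) j * (n%:R + 1 - j%:R) =
  (n%:R + 1) * poch (- n%:R) j :> R.
Proof.
have := @pochSl R (- n.+1%:R) j; rewrite pochS.
have -> : - n.+1%:R + 1 = - n%:R :> R by rewrite -natr1; ring.
rewrite -natr1 => h.
have -> : n%:R + 1 - j%:R = - (- (n%:R + 1) + j%:R) :> R by ring.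
rewrite mulrN h; ring.
Qed.

End PochhammerReal.

(** * Euler's integral and the Gamma function *)

Section EulerIntegral.
Context {R : realType}.
Implicit Types (x t : R) (n : nat).
Notation mu := lebesgue_measure.

Definition euler_integrand x t : R := t `^ (x - 1) * expR (- t).

Definition euler_integral x : \bar R :=
  (\int[mu]_(t in `]0%R, +oo[) (euler_integrand x t)%:E)%E.

Lemma euler_integrand_ge0 x t : 0 <= euler_integrand x t.
Proof. by rewrite mulr_ge0 ?powR_ge0 ?expR_ge0. Qed.

Lemma measurable_euler_integrand (D : set R) x :
  measurable D -> measurable_fun D (EFin \o euler_integrand x).
Proof.
move=> mD; apply/measurable_EFinP; apply: measurable_funTS.
apply: measurable_funM.
  exact: measurable_powR.
by apply: measurableT_comp.
Qed.

(** Compact intervals that increase to the open half-line.  The index is shifted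
    by 2 so that the left end is less than the right end from the start. *)
Definition exhaustion n : set R := `[n.+2%:R^-1, n.+2%:R].

Lemma exhaustion_lt n : n.+2%:R^-1 < n.+2%:R :> R.
Proof.
by rewrite (@lt_le_trans _ _ 1) ?ler1n// invf_lt1 ?ltr1n// ltr0n.
Qed.

Lemma bigcup_exhaustion : \bigcup_n exhaustion n = `]0, +oo[%classic.
Proof.
apply/seteqP; split=> t /=.
  move=> [n _]; rewrite /exhaustion /= !in_itv /= andbT => /andP[nt _].
  by apply: lt_le_trans nt; rewrite invr_gt0.
rewrite in_itv /= andbT => t0.
exists (Num.truncn (t + t^-1)) => //=.
have : t + t^-1 < (Num.truncn (t + t^-1)).+1%:R by exact: truncnS_gt.
rewrite /exhaustion /= in_itv /=; move: (Num.truncn _) => n tn.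
have it0 : 0 < t^-1 by rewrite invr_gt0.
have nn : n.+1%:R <= n.+2%:R :> R by rewrite ler_nat.
apply/andP; split; last lra.
rewrite invf_ple ?posrE ?ltr0n//; lra.
Qed.

(** The integrand is non-negative, so the improper integral is a monotone limit;
    this gives access to integration by parts, available on compact
    intervals, before anything is known about convergence. *)
Lemma cvg_euler_integral x :
  (\int[mu]_(t in exhaustion n) (euler_integrand x t)%:E)%E @[n --> \oo]
    --> euler_integral x.
Proof.
rewrite /euler_integral -bigcup_exhaustion.
have H := @ge0_nondecreasing_set_cvg_integral _ (measurableTypeR R) R exhaustion
  (EFin \o euler_integrand x) lebesgue_measure.
apply: H.
- apply/nondecreasing_seqP => n; rewrite subsetEset.
  move=> t; rewrite /exhaustion /= !in_itv /= => /andP[a b]; apply/andP; split.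
    by apply: le_trans a; rewrite lef_pV2 ?posrE ?ltr0n// ler_nat.
  by apply: le_trans b _; rewrite ler_nat.
- by move=> n; exact: measurable_itv.
- by move=> n; apply: measurable_euler_integrand; exact: measurable_itv.
- by move=> n t _; rewrite lee_fin euler_integrand_ge0.
Qed.

Lemma continuous_powR_pos x t : 0 < t -> {for t, continuous (fun s : R => s `^ x)}.
Proof.
move=> t0; apply/differentiable_continuous/derivable1_diffP.
by apply: derivable_powR; rewrite in_itv /= t0.
Qed.

Lemma continuous_expRN t : {for t, continuous (fun s : R => expR (- s))}.
Proof.
by apply: continuous_comp; [exact: oppr_continuous | exact: continuous_expR].
Qed.

Lemma derivable_LRcontinuous (f : R -> R) a b : a < b -> (forall t, a <= t -> derivable f t 1) ->
  derivable_oo_LRcontinuous f a b.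
Proof.
move=> ab df.
have cf t : a <= t -> {for t, continuous f}.
  by move=> at_; apply/differentiable_continuous/derivable1_diffP/df.
split.
- by move=> t; rewrite in_itv /= => /andP[at_ _]; apply: df; exact: ltW.
- by apply: cvg_at_right_filter; exact: cf.
- by apply: cvg_at_left_filter; apply: cf; exact: ltW.
Qed.

Lemma within_continuous_ge (f : R -> R) a b : (forall t, a <= t -> {for t, continuous f}) ->
  {within `[a, b], continuous f}.
Proof.
move=> cf; apply: continuous_in_subspaceT => t /set_mem /=.
by rewrite in_itv /= => /andP[at_ _]; apply: cf.
Qed.

Lemma is_derive_expRN t : is_derive t 1 (fun s : R => - expR (- s)) (expR (- t)).
Proof.
apply: is_derive_eq.
by rewrite mulrN1 opprK.
Qed.

Lemma euler_integral_parts x n : let a : R := n.+2%:R^-1 in let b : R := n.+2%:R in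
  (\int[mu]_(t in exhaustion n) (euler_integrand (x + 1) t)%:E =
   (a `^ x * expR (- a) - b `^ x * expR (- b))%:E +
   x%:E * \int[mu]_(t in exhaustion n) (euler_integrand x t)%:E)%E.
Proof.
move=> a b; rewrite /exhaustion -/a -/b.
have a0 : 0 < a by rewrite invr_gt0 ltr0n.
have ab : a < b by exact: exhaustion_lt.
have pos t : a <= t -> 0 < t by exact: lt_le_trans.
have := @integration_by_parts R (fun t => t `^ x) (fun t => - expR (- t))
  (fun t => x * t `^ (x - 1)) (fun t => expR (- t)) a b ab.
rewrite /euler_integrand addrK => ->.
- congr (_ + _)%E; first by congr EFin; ring.
  have E t : x * t `^ (x - 1) * - expR (- t) =
      - x * (t `^ (x - 1) * expR (- t)) by ring.
  under eq_integral do rewrite E EFinM.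
  rewrite integralZl//=; first by rewrite EFinN mulNe oppeK.
  apply: continuous_compact_integrable; first exact: segment_compact.
  apply: within_continuous_ge => t at_; apply: continuousM; last exact: continuous_expRN.
  by apply: continuous_powR_pos; exact: pos.
- apply: within_continuous_ge => t at_; apply: continuousM; first exact: cvg_cst.
  by apply: continuous_powR_pos; exact: pos.
- apply: derivable_LRcontinuous => // t at_; apply: derivable_powR.
  by rewrite in_itv /= andbT; exact: pos.
- move=> t; rewrite in_itv /= => /andP[/ltW/pos t0 _].
  by rewrite powR_derive1// in_itv /= t0.
- by apply: within_continuous_ge => t _; exact: continuous_expRN.
- apply: derivable_LRcontinuous => // t _; exact: (@ex_derive _ _ _ _ _ _ _ (is_derive_expRN t)).
- move=> t _; rewrite derive1E; exact: (@derive_val _ _ _ _ _ _ _ (is_derive_expRN t)).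
Qed.

Lemma cvg_invS2 : (n.+2%:R^-1 : R) @[n --> \oo] --> (0 : R).
Proof.
have := @cvg_harmonic R; rewrite -(cvg_shiftS (harmonic : R^nat)); exact.
Qed.

Lemma cvg_invS2_right : (n.+2%:R^-1 : R) @[n --> \oo] --> (0 : R)^'+.
Proof.
move=> P HP.
have H : \forall n \near \oo, 0 < (n.+2%:R^-1 : R) -> P n.+2%:R^-1.
  exact: cvg_invS2 HP.
change (\forall n \near \oo, P (n.+2%:R^-1 : R)).
by apply: filterS H => n; apply; rewrite invr_gt0 ltr0n.
Qed.

(** The boundary terms of the integration by parts: at 0 the power tends to 0, at
    infinity the exponential beats the power, bounded by one of integer
    exponent. *)
Lemma euler_boundary x : 0 < x ->
  ((n.+2%:R^-1 : R) `^ x * expR (- n.+2%:R^-1)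
    - (n.+2%:R : R) `^ x * expR (- n.+2%:R)) @[n --> \oo] --> (0 : R).
Proof.
move=> x0; rewrite -[X in _ --> X](subr0 0); apply: cvgB.
  apply: (@squeeze_cvgr _ _ _ _ (fun=> 0) (fun n => n.+2%:R^-1 `^ x)).
  - near=> n; rewrite mulr_ge0 ?powR_ge0 ?expR_ge0//=.
    by rewrite ler_piMr ?powR_ge0// -expR0 ler_expR oppr_le0 invr_ge0.
  - exact: cvg_cst.
  - exact: (cvg_comp _ _ cvg_invS2_right (powR_cvg0 x0)).
pose m := (Num.truncn x).+1.
apply: (@squeeze_cvgr _ _ _ _ (fun=> 0) (fun n => m.+1`!%:R * n.+2%:R^-1)).
- near=> n; rewrite mulr_ge0 ?powR_ge0 ?expR_ge0//=.
  set b : R := n.+2%:R.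
  have b1 : 1 <= b by rewrite ler1n.
  have b0 : 0 < b by exact: lt_le_trans b1.
  have bm : b `^ x <= b ^+ m.
    rewrite -(powR_mulrn _ (ltW b0)) (ler_powR b1)//.
    by apply: ltW; exact: truncnS_gt.
  have f0 : 0 < m.+1`!%:R :> R by rewrite ltr0n fact_gt0.
  have eb : expR (- b) <= m.+1`!%:R / b ^+ m.+1.
    rewrite expRN -[leRHS]invrK lef_pV2 ?posrE ?expR_gt0 ?invr_gt0 ?divr_gt0 ?exprn_gt0//.
    rewrite invf_div (le_trans _ (expR_ge1Dxn m (ltW b0)))//.
    by rewrite lerDr.
  apply: le_trans (ler_pM _ _ bm eb) _; rewrite ?powR_ge0 ?expR_ge0//.
  have E (z : R) : z != 0 ->
      z ^+ m * (m.+1`!%:R / z ^+ m.+1) = m.+1`!%:R / z.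
    by move=> z0; rewrite exprS; field; rewrite z0 expf_neq0.
  by rewrite E// gt_eqF.
- exact: cvg_cst.
- rewrite -[X in _ --> X](mulr0 (m.+1`!%:R)); apply: cvgM; [exact: cvg_cst|exact: cvg_invS2].
Unshelve. all: by end_near. Qed.

(** An identity of extended reals: at this stage both sides might be infinite. *)
Lemma euler_integral_recur x : 0 < x ->
  (euler_integral (x + 1) = x%:E * euler_integral x)%E.
Proof.
move=> x0.
have cv := @cvg_euler_integral x.
have cb : ((n.+2%:R^-1 `^ x * expR (- n.+2%:R^-1)
    - (n.+2%:R : R) `^ x * expR (- n.+2%:R))%:E)%E @[n --> \oo] --> (0 : \bar R)%E.
  by apply/(cvg_comp _ _ (euler_boundary x0)).
have cs : (\int[mu]_(t in exhaustion n) (euler_integrand (x + 1) t)%:E)%E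
    @[n --> \oo] --> (0 + x%:E * euler_integral x)%E.
  rewrite (_ : (fun n => _) =
    (fun n => (n.+2%:R^-1 `^ x * expR (- n.+2%:R^-1)
      - (n.+2%:R : R) `^ x * expR (- n.+2%:R))%:E +
     x%:E * \int[mu]_(t in exhaustion n) (euler_integrand x t)%:E)%E); last first.
    by apply/funext => n; exact: euler_integral_parts.
  by apply: (cvgeD _ cb); last exact: cvgeZl.
rewrite add0e in cs.
exact: (cvg_unique _ (@cvg_euler_integral (x + 1)) cs).
Qed.

Lemma euler_integral_ge0 x : (0 <= euler_integral x)%E.
Proof. by apply: integral_ge0 => t _; rewrite lee_fin euler_integrand_ge0. Qed.

Lemma euler_integral1 : euler_integral 1 = 1%E.
Proof.
rewrite /euler_integral integral_itv_obnd_cbnd; last exact: measurable_euler_integrand.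
have -> : 1%E = (0%:E - (- expR (- 0 : R))%:E)%E.
  by rewrite oppr0 expR0 -EFinB sub0r opprK.
under eq_integral do rewrite /euler_integrand subrr powRr0 mul1r.
apply: (@ge0_continuous_FTC2y _ _ (fun t => - expR (- t))).
- by move=> t _; exact: expR_ge0.
- apply: continuous_subspaceT => t; exact: continuous_expRN.
- by rewrite -oppr0; apply: cvgN; exact: cvgr_expR.
- by move=> t _; exact: (@ex_derive _ _ _ _ _ _ _ (is_derive_expRN t)).
- apply: cvg_at_right_filter; apply: cvgN; exact: continuous_expRN.
- by move=> t _; rewrite derive1E; exact: (@derive_val _ _ _ _ _ _ _ (is_derive_expRN t)).
Qed.

(** On [1, 2] the integrand is dominated by the sum of those for 1 and 2, whose
    integrals are explicit; the functional equation carries finiteness from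
    there down to (0, 1] and then up by steps of 1. *)
Lemma euler_integral_fin_num x : 0 < x -> euler_integral x \is a fin_num.
Proof.
have ge1_fin y : 1 <= y <= 2 -> (euler_integral y < +oo)%E.
  move=> /andP[y1 y2].
  apply: (@le_lt_trans _ _ (euler_integral 1 + euler_integral 2)%E); last first.
    have -> : 2 = 1 + 1 :> R by ring.
    by rewrite euler_integral_recur// mul1e euler_integral1 -EFinD ltry.
  rewrite /euler_integral -ge0_integralD//=; first last.
  - exact: measurable_euler_integrand.
  - by move=> t _; rewrite lee_fin euler_integrand_ge0.
  - exact: measurable_euler_integrand.
  - by move=> t _; rewrite lee_fin euler_integrand_ge0.
  apply: ge0_le_integral => //=.
  - by move=> t _; rewrite lee_fin euler_integrand_ge0.
  - exact: measurable_euler_integrand.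
  - apply/measurable_EFinP; apply: measurable_funD.
      by apply/measurable_EFinP; exact: measurable_euler_integrand.
    by apply/measurable_EFinP; exact: measurable_euler_integrand.
  move=> t; rewrite in_itv /= andbT => t0.
  rewrite -EFinD lee_fin /euler_integrand -mulrDl ler_wpM2r ?expR_ge0//.
  rewrite subrr powRr0 (_ : 2 - 1 = 1); last by ring.
  have -> : t `^ 1 = t by rewrite powRr1// ltW.
  have [t1|t1] := leP t 1.
    apply: (@le_trans _ _ 1); last by lra.
    rewrite -[leRHS](powRr0 t) ger_powR ?t0//; lra.
  apply: (@le_trans _ _ t); last by lra.
  rewrite -[leRHS](powRr1 (ltW t0)) (ler_powR (ltW t1))//; lra.
have fin_of y : (euler_integral y < +oo)%E -> euler_integral y \is a fin_num.
  by move=> h; rewrite ge0_fin_numE// euler_integral_ge0.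
have le1 y : 0 < y <= 1 -> euler_integral y \is a fin_num.
  move=> /andP[y0 y1]; have /fin_of : (euler_integral (y + 1) < +oo)%E.
    by apply: ge1_fin; apply/andP; split; lra.
  rewrite euler_integral_recur// => h; apply: fin_of; move: h.
  have := euler_integral_ge0 y; case: (euler_integral y) => [r _ _|_|//].
    exact: ltry.
  by rewrite gt0_muley ?lte_fin.
move=> x0; have [m] : exists m : nat, x <= m.+1%:R.
  by exists (Num.truncn x); apply: ltW; exact: truncnS_gt.
elim: m x x0 => [|m IH] x x0 xm; first by apply: le1; rewrite x0.
have [x1|x1] := leP x 1; first by apply: le1; rewrite x0.
rewrite -(subrK 1 x) euler_integral_recur ?subr_gt0//.
rewrite fin_numM// IH ?subr_gt0//.
by rewrite lerBlDr -natr1 in xm *.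
Qed.

(** For an argument at least 1 the integrand is bounded below on [1, 2]; the
    functional equation covers the remaining arguments. *)
Lemma euler_integral_gt0 x : 0 < x -> (0 < euler_integral x)%E.
Proof.
suff ge1 y : 1 <= y -> (0 < euler_integral y)%E.
  move=> x0; have : (0 < euler_integral (x + 1))%E by apply: ge1; lra.
  by rewrite euler_integral_recur// pmule_rgt0.
move=> y1; apply: (@lt_le_trans _ _ (\int[mu]_(t in `[1%R, 2%R]) (expR (- 2))%:E)%E).
  rewrite integral_cst//= lebesgue_measure_itv /= lte_fin ltr1n /=.
  by rewrite -EFinD -EFinM lte_fin mulr_gt0 ?expR_gt0//; lra.
apply: (@le_trans _ _ (\int[mu]_(t in `[1%R, 2%R]) (euler_integrand y t)%:E)%E).
  apply: ge0_le_integral => //=.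
    exact: measurable_euler_integrand.
  move=> t; rewrite in_itv /= => /andP[t1 t2].
  rewrite lee_fin /euler_integrand -[leLHS]mul1r ler_pM ?expR_ge0//.
    by rewrite -[leLHS](powRr0 t) (ler_powR t1)//; lra.
  by rewrite ler_expR; lra.
apply: ge0_subset_integral => //=.
- exact: measurable_euler_integrand.
- by move=> t _; rewrite lee_fin euler_integrand_ge0.
- move=> t /=; rewrite !in_itv /= => /andP[t1 _]; rewrite andbT.
  by apply: lt_le_trans t1.
Qed.

Lemma Gamma_pos x : 0 < x -> Gamma x = fine (euler_integral x).
Proof.
move=> x0; rewrite /Gamma /Rintegral /poch.
have -> : Num.truncn (1 - x) = 0%N.
  by apply/truncn0Pn; rewrite -ltNge; lra.
rewrite big_ord0 divr1; congr fine; apply: eq_integral => t _.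
by rewrite /euler_integrand addr0.
Qed.

Lemma Gamma_gt0 x : 0 < x -> 0 < Gamma x.
Proof.
by move=> x0; rewrite Gamma_pos// fine_gt0// euler_integral_gt0//= ltey_eq euler_integral_fin_num.
Qed.

Lemma Gamma_recur_pos x : 0 < x -> Gamma (x + 1) = x * Gamma x.
Proof.
move=> x0; rewrite !Gamma_pos ?addr_gt0// euler_integral_recur// fineM//.
exact: euler_integral_fin_num.
Qed.

End EulerIntegral.

Lemma nonposint_addn_neq0 {R : realType} (z : R) :
  ~~ nonposint z -> forall m : nat, z + m%:R != 0.
Proof.
move=> h m; apply: contra h => /eqP zm; rewrite /nonposint.
have -> : - z = m%:R by lra.
exact: natr_nat.
Qed.

Lemma Gamma_le0 {R : realType} (x : R) :
  x <= 0 -> Gamma x = Gamma (x + (Num.truncn (1 - x))%:R) / poch x (Num.truncn (1 - x)).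
Proof.
move=> x0; rewrite {1}/Gamma; set m := Num.truncn _; congr (_ / _).
rewrite Gamma_pos //.
have := truncnS_gt (1 - x); rewrite -/m -natr1; lra.
Qed.

Lemma Gamma_neq0 {R : realType} (x : R) :
  (forall m : nat, x + m%:R != 0) -> Gamma x != 0.
Proof.
move=> hx; have [x0|x0] := ltP 0 x; first by rewrite gt_eqF// Gamma_gt0.
rewrite Gamma_le0// mulf_neq0 ?invr_eq0 ?poch_neq0// gt_eqF// Gamma_gt0//.
by have := truncnS_gt (1 - x); rewrite -natr1; lra.
Qed.

(** For x <= 0 passing to x + 1 removes one step of the continuation: the argument
    of the integral is the same and the product loses its first factor x. *)
Lemma Gamma_recur {R : realType} (x : R) :
  (forall m : nat, x + m%:R != 0) -> Gamma (x + 1) = x * Gamma x.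
Proof.
move=> hx; have [x0|x0] := ltP 0 x; first exact: Gamma_recur_pos.
have x_neq0 : x != 0 by have := hx 0; rewrite addr0.
have hp j : poch x j != 0 by apply: poch_neq0.
rewrite (Gamma_le0 x0).
have [x1|x1] := ltP 0 (x + 1).
  have -> : Num.truncn (1 - x) = 1%N.
    by apply: truncn_def; apply/andP; split; lra.
  by rewrite /poch big_ord1 addr0 mulrC mulfVK.
rewrite (Gamma_le0 x1).
have t0 : 0 <= 1 - (x + 1) by lra.
have /andP[m1 m2] := truncn_itv t0.
have -> : Num.truncn (1 - x) = (Num.truncn (1 - (x + 1))).+1.
  by apply: truncn_def; rewrite -!natr1 in m2 *; apply/andP; split; lra.
move: (Num.truncn _) => m; rewrite pochSl.
have -> : x + 1 + m%:R = x + m.+1%:R by rewrite -natr1; ring.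
have hp1 : poch (x + 1) m != 0.
  by have := hp m.+1; rewrite pochSl mulf_eq0 negb_or => /andP[].
by field; rewrite x_neq0 hp1.
Qed.

(** * Polynomial families with one member of each degree *)

Lemma scalarZ {R : realType} (L : {scalar {poly R}}) (a : R) (p : {poly R}) :
  L (a *: p) = a * L p.
Proof. exact: linearZ. Qed.

Section GradedFamily.
Context {R : realType}.
Variable e : nat -> {poly R}.
Hypothesis size_e : forall n, size (e n) = n.+1.
Implicit Types (p : {poly R}) (n : nat).

Definition top_coef n p : R := p`_n / (e n)`_n.

Lemma graded_lead_neq0 n : (e n)`_n != 0.
Proof.
have -> : (e n)`_n = lead_coef (e n) by rewrite lead_coefE size_e.
by rewrite lead_coef_eq0 -size_poly_eq0 size_e.
Qed.

Lemma size_sub_top n p :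
  (size p <= n.+1)%N -> (size (p - top_coef n p *: e n)%R <= n)%N.
Proof.
move=> sp; apply/leq_sizeP => j; rewrite leq_eqVlt => /predU1P[<-|nj].
  by rewrite coefB coefZ /top_coef mulfVK ?subrr// graded_lead_neq0.
rewrite coefB coefZ [p`_j]nth_default ?(leq_trans sp)//.
by rewrite [(e n)`_j]nth_default ?size_e// mulr0 subr0.
Qed.

Lemma graded_ind (P : {poly R} -> Prop) n :
  P 0 -> (forall (a : R) i p, (i < n)%N -> P p -> P (a *: e i + p)) ->
  forall p, (size p <= n)%N -> P p.
Proof.
elim: n => [|n IH] P0 Ps p sp.
  by have -> : p = 0 by apply/eqP; rewrite -size_poly_leq0.
rewrite -(subrK (top_coef n p *: e n) p) addrC; apply: (Ps) => //.
apply: IH (size_sub_top sp) => // a i r lin; apply: Ps.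
exact: ltnW.
Qed.

Lemma graded_eq (L M : {scalar {poly R}}) :
  (forall n, L (e n) = M (e n)) -> L =1 M.
Proof.
move=> LM p; apply: (@graded_ind (fun p => L p = M p) (size p)) => //.
  by rewrite !linear0.
by move=> a i r _ IH; rewrite !linearP LM IH.
Qed.

Fixpoint graded_eval (v : nat -> R) n p : R :=
  if n is m.+1 then
    top_coef m p * v m + graded_eval v m (p - top_coef m p *: e m)
  else 0.

Lemma graded_eval_linear v n : scalar (graded_eval v n).
Proof.
elim: n => [|n IH] a p r /=; first by rewrite mulr0 addr0.
have -> : top_coef n (a *: p + r) = a * top_coef n p + top_coef n r.
  by rewrite /top_coef coefD coefZ mulrDl mulrA.
set x := top_coef n p; set y := top_coef n r.
have -> : a *: p + r - (a * x + y) *: e n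
   = a *: (p - x *: e n) + (r - y *: e n).
  by rewrite scalerBr scalerDl scalerA opprD addrACA.
rewrite IH; ring.
Qed.

Lemma graded_eval_size v n m p : (size p <= m)%N -> (m <= n)%N ->
  graded_eval v n p = graded_eval v m p.
Proof.
move=> sp; elim: n => [|n IH]; first by rewrite leqn0 => /eqP ->.
rewrite leq_eqVlt => /predU1P[-> //|]; rewrite ltnS => mn /=.
have -> : top_coef n p = 0.
  by rewrite /top_coef nth_default ?mul0r// (leq_trans sp).
by rewrite mul0r add0r scale0r subr0 IH.
Qed.

(** A linear functional may be prescribed freely on such a family.  It is computed
    by eliminating leading coefficients, with the size of the polynomial as fuel;
    surplus fuel does not change the value, which is what makes the
    functional additive. *)
Lemma graded_functional (v : nat -> R) :
  exists L : {scalar {poly R}}, forall n, L (e n) = v n.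
Proof.
pose F p := graded_eval v (size p) p.
have F_lin : scalar F.
  move=> a p r; rewrite /F.
  pose m := maxn (size p) (size r).
  rewrite -(@graded_eval_size v m (size p) p)// ?leq_maxl//.
  rewrite -(@graded_eval_size v m (size r) r)// ?leq_maxr//.
  rewrite -(@graded_eval_size v m _ (a *: p + r))// ?graded_eval_linear//.
  rewrite (leq_trans (size_polyD _ _))// geq_max leq_maxr andbT.
  by rewrite (leq_trans (size_scale_leq _ _))// leq_maxl.
pose L : {scalar {poly R}} := HB.pack F (GRing.isLinear.Build _ _ _ _ F F_lin).
exists L => n; rewrite /L /= /F size_e /=.
have -> : top_coef n (e n) = 1 by rewrite /top_coef divff// graded_lead_neq0.
rewrite scale1r subrr mul1r.
have := graded_eval_linear v n (-1) 0 0.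
by rewrite scaler0 addr0 mulN1r addNr => ->; rewrite addr0.
Qed.

End GradedFamily.

(** * Shifts of polynomials *)

Section Shift.
Context {R : realType}.
Implicit Types (p q : {poly R}) (l : int).

HB.instance Definition _ l := GRing.LRMorphism.copy (@shift_op R l)
  (comp_poly ('X + (l%:~R)%:P)).

Lemma shift_opX l : shift_op l ('X : {poly R}) = 'X + (l%:~R)%:P.
Proof. exact: comp_polyX. Qed.

Lemma shift_opC l (a : R) : shift_op l a%:P = a%:P.
Proof. exact: comp_polyC. Qed.

Lemma shift_opD l l' p : shift_op l (shift_op l' p) = shift_op (l + l') p.
Proof.
rewrite /shift_op -comp_polyA comp_polyD comp_polyX comp_polyC.
by rewrite intrD polyCD addrA.
Qed.

Lemma shift_op0 p : shift_op 0 p = p.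
Proof. by rewrite /shift_op addr0 comp_polyXr. Qed.

End Shift.

(** * The basis of falling factorials *)

Section FactorialBasis.
Context {R : realType}.
Implicit Types (p : {poly R}) (j n : nat).

Definition fbasis j : {poly R} := poch (- 'X) j.

Lemma fbasis0 : fbasis 0 = 1. Proof. by rewrite /fbasis /poch big_ord0. Qed.

Lemma fbasisS j : fbasis j.+1 = fbasis j * (- 'X + j%:R).
Proof. exact: pochS. Qed.

Lemma fbasisE j : fbasis j = (-1) ^+ j *: \prod_(i < j) ('X - i%:R%:P).
Proof.
elim: j => [|j IH]; first by rewrite fbasis0 big_ord0 scale1r.
rewrite fbasisS big_ord_recr /= exprS -!mul_polyC IH -mul_polyC; ring.
Qed.

Lemma size_fbasis j : size (fbasis j) = j.+1.
Proof.
rewrite fbasisE size_scale ?signr_eq0//.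
by rewrite size_prod_XsubC /index_enum -enumT size_enum_ord.
Qed.

Lemma coef_fbasis j : (fbasis j)`_j = (-1) ^+ j.
Proof.
rewrite fbasisE coefZ.
have := monic_prod_XsubC (index_enum 'I_j) xpredT (fun i : 'I_j => (i : nat)%:R : R).
rewrite monicE lead_coefE size_prod_XsubC /index_enum -enumT size_enum_ord /=.
by move=> /eqP ->; rewrite mulr1.
Qed.

Lemma mulX_fbasis j : 'X * fbasis j = j%:R *: fbasis j - fbasis j.+1.
Proof. rewrite fbasisS -mul_polyC; ring. Qed.

Lemma shift_fbasis (l : int) j :
  shift_op l (fbasis j) = poch (- 'X - (l%:~R)%:P) j.
Proof. by rewrite poch_rmorph rmorphN /= shift_opX opprD. Qed.

(** The factor x lengthens the shifted product (1 - x)_j by its missing first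
    factor. *)
Lemma X_shift_fbasis j :
  'X * shift_op (-1) (fbasis j) = - fbasis j.+1.
Proof.
rewrite shift_fbasis /fbasis pochSl mulNr opprK.
by congr (_ * poch _ _); ring.
Qed.

Lemma delta_fbasis j :
  shift_op 1 (fbasis j.+1) - fbasis j.+1 = - (j.+1%:R *: fbasis j).
Proof.
rewrite shift_fbasis pochSl.
have -> : - 'X - (1%:~R : R)%:P + 1 = - 'X :> {poly R}.
  by rewrite polyC1 subrK.
rewrite fbasisS -/(fbasis j) -!mul_polyC -natr1 rmorphD /= !polyC1; ring.
Qed.

End FactorialBasis.

(** * Coefficients of the Hahn polynomials *)

Section HahnPolynomials.
Context {R : realType}.
Implicit Types (p : {poly R}) (j n : nat) (al c N : R).

Lemma hahn_op_linear al c N : linear (@hahn_op R al c N).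
Proof.
move=> a p r; rewrite /hahn_op !linearP /= -!mul_polyC; ring.
Qed.

HB.instance Definition _ al c N :=
  GRing.isLinear.Build R {poly R} {poly R} *:%R (@hahn_op R al c N)
    (hahn_op_linear al c N).

Lemma hahn_opE al c N p : hahn_op al c N p =
  'X * ('X - al%:P) * (shift_op (-1) p - p)
  + ('X + c%:P) * ('X - (N - 1)%:P) * (shift_op 1 p - p)
  + (theta al c N 0)%:P * p.
Proof.
rewrite /hahn_op /theta -!mul_polyC; ring.
Qed.

(** The operator is triangular with two terms in this basis: in hahn_opE both
    difference parts produce x (x - 1) ... (x - j), with opposite signs. *)
Lemma hahn_op_fbasis al c N j : hahn_op al c N (fbasis j) =
  theta al c N j *: fbasis j
  - (j%:R * (j%:R - N) * (j%:R + c - 1)) *: fbasis j.-1.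
Proof.
rewrite hahn_opE mulrBr.
have -> : 'X * ('X - al%:P) * shift_op (-1) (fbasis j)
   = - ('X - al%:P) * fbasis j.+1 :> {poly R}.
  by rewrite [_ * (_ - _)]mulrC -mulrA X_shift_fbasis mulrN mulNr.
case: j => [|j].
  rewrite fbasis0 rmorph1 fbasisS fbasis0 subrr !mul0r scale0r -!mul_polyC.
  rewrite /theta; ring.
rewrite delta_fbasis !fbasisS /= -!mul_polyC /theta -!natr1; ring.
Qed.

Definition hahn_coef al c N n j : R :=
  poch (- n%:R) j * poch (1 - N + j%:R) (n - j) * poch (c + j%:R) (n - j)
      / (poch (n%:R + al + c - N + j%:R) (n - j) * j`!%:R).

Lemma hahnE al c N n :
  hahn al c N n = \sum_(j < n.+1) hahn_coef al c N n j *: fbasis j.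
Proof. by []. Qed.

Section Generic.
Variables al c N : R.
Hypothesis hu : forall m : nat, al + c - N + m.+1%:R != 0.

Lemma hahn_den_neq0 n j : (j <= n)%N ->
  poch (n%:R + al + c - N + j%:R) (n - j) != 0 :> R.
Proof.
move=> jn; apply: poch_neq0 => i iL.
have n0 : (0 < n)%N by case: n jn iL => // [[|]].
have -> : n%:R + al + c - N + j%:R + i%:R = al + c - N + (n + j + i).-1.+1%:R.
  rewrite prednK ?addn_gt0 ?n0// !natrD; ring.
exact: hu.
Qed.

Lemma hahn_coef_top n : hahn_coef al c N n n = (-1) ^+ n.
Proof.
rewrite /hahn_coef subnn !poch0 !mulr1 mul1r poch_opp.
by rewrite mulfK// fact_neq0.
Qed.

(** The coefficient identity behind the eigenvalue equation; the left factor is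
    theta n - theta j. *)
Lemma hahn_coefS n j : (j < n)%N ->
  (n%:R - j%:R) * (n%:R + j%:R + al + c - N) * hahn_coef al c N n j =
  - ((j%:R + 1) * (j%:R + 1 - N) * (j%:R + c)) * hahn_coef al c N n j.+1.
Proof.
move=> jn; rewrite /hahn_coef.
have /= := hahn_den_neq0 (ltnW jn); have /= := hahn_den_neq0 jn.
have [m ->] : exists m, n = (j + m).+1.
  by exists (n - j.+1)%N; rewrite -addSn subnKC.
rewrite subSS subSn ?leq_addr// addKn.
rewrite (pochS _ j) !(pochSl _ m).
rewrite (_ : 1 - N + j%:R + 1 = 1 - N + j.+1%:R); last by rewrite -natr1; ring.
rewrite (_ : c + j%:R + 1 = c + j.+1%:R); last by rewrite -natr1; ring.
set n1 := (j + m).+1.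
rewrite (_ : n1%:R + al + c - N + j%:R + 1 = n1%:R + al + c - N + j.+1%:R);
  last by rewrite -natr1; ring.
move: (poch _ m) => D; rewrite mulf_eq0 negb_or => D0 /andP[w0 _].
rewrite factS natrM.
have f0 := fact_neq0 j.
have j0 : 1 + j%:R != 0 :> R by rewrite addrC natr1.
rewrite -!natr1 in D0 w0 *.
field.
by rewrite f0 D0 addrC j0 /=; move: w0; rewrite natrD.
Qed.

(** The coefficient identity behind the ladder relation hahn_ladder_X.  The
    denominators are kept on the left, since for n = 0 and al + c = N one of them
    vanishes. *)
Lemma hahn_coefSn n j : (j <= n)%N ->
  (n%:R + 1 - j%:R) * (2 * n%:R + al + c - N) * (2 * n%:R + al + c - N + 1)
    * hahn_coef al c N n.+1 j =
  (n%:R + 1) * (n%:R + 1 - N) * (n%:R + c) * (n%:R + j%:R + al + c - N)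
    * hahn_coef al c N n j.
Proof.
move=> jn; rewrite /hahn_coef.
have := hahn_den_neq0 (leqW jn); have := hahn_den_neq0 jn.
rewrite subSn// !(pochS _ (n - j)).
have jnE : (n - j)%:R = n%:R - j%:R :> R by rewrite natrB.
have := pochSl (n%:R + al + c - N + j%:R) (n - j).+1.
rewrite !pochS.
rewrite (_ : n.+1%:R + al + c - N + j%:R = n%:R + al + c - N + j%:R + 1);
  last by rewrite -natr1; ring.
set E := poch _ _ * (_ + 1 + _); set D := poch _ _.
have AB := @poch_oppS R n j; move: AB.
move: (poch (- n.+1%:R) j) => A; move: (poch (- n%:R) j) => B AB.
rewrite -natr1 jnE.
set w := n%:R + al + c - N + j%:R => wE D0 E0.
have n0 : n%:R + 1 != 0 :> R by rewrite natr1.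
have -> : n%:R + j%:R + al + c - N = w by rewrite /w; ring.
have -> : w = D * (w + (n%:R - j%:R)) * (w + (n%:R - j%:R + 1)) / E.
  by rewrite wE mulfK.
have -> : B = A * (n%:R + 1 - j%:R) / (n%:R + 1) by rewrite AB mulrAC mulfV// mul1r.
move: D E wE D0 E0 => D E _ D0 E0; rewrite /w.
field.
by rewrite fact_neq0 D0 n0 E0.
Qed.

End Generic.
End HahnPolynomials.

(** The coefficient identity behind hahn_delta; the denominators on the two sides
    are the same, because al + c - N grows by 2 while n decreases by 1. *)
Lemma hahn_coef_shift {R : realType} (al c N : R) n j : (j <= n)%N ->
  j.+1%:R * hahn_coef al c N n.+1 j.+1
    = - (n.+1%:R * hahn_coef al (c + 1) (N - 1) n j).
Proof.
move=> jn; rewrite /hahn_coef subSS pochSl.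
have -> : - n.+1%:R + 1 = - n%:R :> R by rewrite -natr1; ring.
have -> : 1 - N + j.+1%:R = 1 - (N - 1) + j%:R by rewrite -natr1; ring.
have -> : c + j.+1%:R = c + 1 + j%:R by rewrite -natr1; ring.
have -> : n.+1%:R + al + c - N + j.+1%:R = n%:R + al + (c + 1) - (N - 1) + j%:R.
  by rewrite -!natr1; ring.
rewrite factS natrM !invfM.
have j0 : j.+1%:R != 0 :> R by rewrite pnatr_eq0.
move: (poch _ _)^-1 (j`!%:R)^-1 => D F.
by field.
Qed.

(** * The eigenvalue equation of the Hahn polynomials *)

Section HahnEigen.
Context {R : realType}.
Variables al c N : R.
Hypothesis hu : forall m : nat, al + c - N + m.+1%:R != 0.
Implicit Types (p : {poly R}) (j n : nat).

Local Notation h := (hahn al c N).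

Lemma hahn_lead n : (h n)`_n = 1 /\ (size (h n) <= n.+1)%N.
Proof.
have sz m : (size (\sum_(j < m) hahn_coef al c N n j *: fbasis j)%R <= m)%N.
  apply: (leq_trans (size_sum _ _ _)); apply/bigmax_leqP => i _.
  by rewrite (leq_trans (size_scale_leq _ _))// size_fbasis.
rewrite hahnE; split; last exact: sz.
rewrite big_ord_recr /= coefD [X in X + _]nth_default ?sz// add0r coefZ.
by rewrite coef_fbasis hahn_coef_top -expr2 sqrr_sign.
Qed.

Lemma hahn_coef_n n : (h n)`_n = 1. Proof. exact: (hahn_lead n).1. Qed.

Lemma size_hahn n : size (h n) = n.+1.
Proof.
apply/eqP; rewrite eqn_leq (hahn_lead n).2 /= ltnNge.
apply/negP => sz; have := hahn_coef_n n.
by rewrite nth_default// => /esym/eqP; rewrite oner_eq0.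
Qed.

Lemma hahn0 : h 0 = 1.
Proof. by rewrite hahnE big_ord1 hahn_coef_top fbasis0 scale1r. Qed.

Lemma theta_diff n m : theta al c N n - theta al c N m =
  (n%:R - m%:R) * (n%:R + m%:R + al + c - N).
Proof. rewrite /theta; ring. Qed.

Lemma theta_inj n m : n != m -> theta al c N n - theta al c N m != 0.
Proof.
wlog mn : n m / (m < n)%N.
  move=> H nm; case: (ltngtP m n) => [mn|mn|mn]; first exact: H.
    by rewrite -opprB oppr_eq0 H// eq_sym.
  by rewrite mn eqxx in nm.
move=> _; rewrite theta_diff mulf_neq0//; first by rewrite subr_eq0 eqr_nat gtn_eqF.
have -> : n%:R + m%:R + al + c - N = al + c - N + (n + m).-1.+1%:R.
  by rewrite prednK ?addn_gt0 ?(leq_ltn_trans _ mn)// natrD; ring.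
exact: hu.
Qed.

Lemma hahn_eigen n : hahn_op al c N (h n) = theta al c N n *: h n.
Proof.
rewrite hahnE linear_sum /=.
under eq_bigr do rewrite linearZ /= hahn_op_fbasis scalerBr.
rewrite sumrB [X in _ - X]big_ord_recl /= !mul0r scale0r scaler0 add0r.
rewrite scaler_sumr [X in X - _]big_ord_recr [in RHS]big_ord_recr /=.
rewrite addrAC -sumrB; congr (_ + _); last by rewrite !scalerA mulrC.
apply: eq_bigr => i _; rewrite /bump /= add1n /=.
rewrite !scalerA -scalerBl; congr (_ *: _).
have E := hahn_coefS hu (ltn_ord i); rewrite -theta_diff in E.
rewrite -[theta al c N n](subrK (theta al c N i)) [RHS]mulrDl E -natr1; ring.
Qed.

Lemma hahn_op_size p n : (size p <= n)%N -> (size (hahn_op al c N p) <= n)%N.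
Proof.
move: p; apply: (graded_ind size_hahn (P := fun r => (size (hahn_op al c N r) <= n)%N)) => [|a i r lin sr]; first by rewrite linear0 size_poly0.
rewrite linearP /= hahn_eigen (leq_trans (size_polyD _ _))// geq_max sr andbT.
by rewrite scalerA (leq_trans (size_scale_leq _ _))// size_hahn.
Qed.

(** The eigenvalues are distinct and the operator preserves degrees, so an
    eigenfunction for theta n of degree less than n has no leading term. *)
Lemma hahn_eigen_inj p n : (size p <= n)%N ->
  hahn_op al c N p = theta al c N n *: p -> p = 0.
Proof.
move=> pn Dp; apply/eqP; rewrite -size_poly_eq0.
case sp : (size p) => [//|m]; exfalso.
have pm : (size p <= m.+1)%N by rewrite sp.
have sg := size_sub_top size_hahn pm.
have aE : top_coef h m p = p`_m by rewrite /top_coef hahn_coef_n divr1.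
move: sg; rewrite aE; set g := p - _ => sg.
have pE : p = p`_m *: h m + g by rewrite addrC subrK.
have := congr1 (fun r : {poly R} => r`_m) Dp.
rewrite {1}pE linearP /= hahn_eigen coefD !coefZ hahn_coef_n.
rewrite [(hahn_op _ _ _ g)`_m]nth_default ?hahn_op_size// addr0 mulr1 => /eqP.
rewrite mulrC -subr_eq0 -mulrBl mulf_eq0 => /orP[|].
  by apply/negP/theta_inj; rewrite neq_ltn -ltnS -sp ltnS; move: pn; rewrite sp => ->.
apply/negP; have -> : p`_m = lead_coef p by rewrite lead_coefE sp.
by rewrite lead_coef_eq0 -size_poly_eq0 sp.
Qed.

Lemma hahn_delta n :
  shift_op 1 (h n.+1) - h n.+1 = n.+1%:R *: hahn al (c + 1) (N - 1) n.
Proof.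
rewrite !hahnE linear_sum /= -sumrB big_ord_recl /= fbasis0.
rewrite linearZ /= rmorph1 subrr add0r scaler_sumr.
apply: eq_bigr => i _; rewrite /bump /= add1n linearZ /= -scalerBr delta_fbasis.
rewrite scalerN !scalerA mulrC hahn_coef_shift ?scaleNr ?opprK//.
by rewrite -ltnS.
Qed.

End HahnEigen.

(** * Reflection and ladder relations *)

Section Reflection.
Context {R : realType}.
Implicit Types (p : {poly R}) (j n : nat) (al c N : R).

Lemma shift_comp (l : int) p (a : R) :
  shift_op l p \Po ('X - a%:P) = shift_op l (p \Po ('X - a%:P)).
Proof.
rewrite /shift_op -!comp_polyA; congr (_ \Po _).
by rewrite comp_polyD comp_polyX comp_polyC comp_polyB comp_polyX comp_polyC addrAC.
Qed.

Lemma hahn_op_comp al c N p :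
  hahn_op al c N (p \Po ('X - al%:P)) =
  hahn_op (- al) (al + c) (N - al) p \Po ('X - al%:P).
Proof.
rewrite /hahn_op !(comp_polyD, comp_polyM, comp_polyB, comp_polyZ) !comp_polyC.
rewrite !shift_comp !comp_polyX !(raddfN, comp_polyC) /= ?comp_polyC -!mul_polyC; ring.
Qed.

Section Generic.
Variables al c N : R.
Hypothesis hu : forall m : nat, al + c - N + m.+1%:R != 0.

Lemma reflected_generic (m : nat) : - al + (al + c) - (N - al) + m.+1%:R != 0.
Proof. by have := hu m; congr (_ != 0); ring. Qed.

(** Under x -> x - al the two factors of the coefficient x (x - al) of the Hahn
    operator are exchanged, and the operator becomes the Hahn operator of
    the parameters (- al, al + c, N - al), with the same eigenvalues.  Both sides
    are monic eigenfunctions for theta n, hence equal by hahn_eigen_inj. *)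
Lemma hahn_reflection n :
  hahn al c N n = hahn (- al) (al + c) (N - al) n \Po ('X - al%:P).
Proof.
apply/eqP; rewrite -subr_eq0; apply/eqP.
set g := hahn (- al) _ _ n.
have sgc : size (g \Po ('X - al%:P)) = n.+1.
  by rewrite size_comp_poly2 ?size_XsubC// size_hahn.
have gcn : (g \Po ('X - al%:P))`_n = 1.
  have : lead_coef (g \Po ('X - al%:P)) = 1.
    rewrite lead_coef_comp ?size_XsubC// lead_coefXsubC expr1n mulr1.
    by rewrite lead_coefE size_hahn hahn_coef_n.
  by rewrite lead_coefE sgc.
apply: (hahn_eigen_inj hu (n := n)).
  apply/leq_sizeP => j; rewrite leq_eqVlt => /predU1P[<-|nj].
    by rewrite coefB hahn_coef_n// gcn subrr.
  by rewrite coefB !nth_default ?subr0 ?sgc ?size_hahn.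
rewrite linearB /= hahn_eigen// hahn_op_comp hahn_eigen; last exact: reflected_generic.
rewrite comp_polyZ scalerBr; congr (_ - _ *: _).
by rewrite /theta; ring.
Qed.

End Generic.

Lemma mulX_nabla_fbasis j :
  'X * nabla (fbasis j) = j%:R *: fbasis j :> {poly R}.
Proof.
by rewrite /nabla mulrBr mulX_fbasis X_shift_fbasis opprK subrK.
Qed.

(** The first factor of beta n: beta n = ladder_coef n * (gamma n.+1 / gamma n). *)
Definition ladder_coef al c N n : R :=
  n%:R * (n%:R + al - N) * (n%:R + al + c - 1)
    / ((2 * n%:R + al + c - N - 1) * (2 * n%:R + al + c - N - 2)).

Lemma nabla_is_linear : linear (@nabla R).
Proof. by move=> a p r; rewrite /nabla linearP /= -!mul_polyC; ring. Qed.

HB.instance Definition _ :=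
  GRing.isLinear.Build R {poly R} {poly R} *:%R (@nabla R) nabla_is_linear.

Section Ladder.
Variables al c N : R.
Hypothesis hu0 : forall m : nat, al + c - N + m%:R != 0.

Let hu m : al + c - N + m.+1%:R != 0 := hu0 m.+1.

(** x nabla multiplies the j-th basis element by j, so this is an identity between
    coefficients, which is hahn_coefSn. *)
Lemma hahn_ladder_X n : let d := (n%:R + 1) * (n%:R + 1 - N) * (n%:R + c)
     / ((2 * n%:R + al + c - N) * (2 * n%:R + al + c - N + 1)) in
  'X * nabla (hahn al c N n.+1 + d *: hahn al c N n) =
  n.+1%:R *: hahn al c N n.+1
  - ((n%:R + al + c - N) * d) *: hahn al c N n.
Proof.
move=> d.
have mulsum m k : 'X * nabla (\sum_(j < m) hahn_coef al c N k j *: fbasis j) =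
    \sum_(j < m) (j%:R * hahn_coef al c N k j) *: fbasis j.
  rewrite linear_sum mulr_sumr; apply: eq_bigr => i _.
  by rewrite linearZ /= -scalerAr mulX_nabla_fbasis scalerA mulrC.
rewrite linearD linearZ mulrDr -scalerAr !hahnE !mulsum.
rewrite 2!(@big_ord_recr _ _ _ n.+1) /= scalerDr scalerA addrAC [RHS]addrAC.
congr (_ + _); rewrite !scaler_sumr -big_split -sumrB /=.
apply: eq_bigr => i _; rewrite !scalerA -scalerDl -scalerBl; congr (_ *: _).
have := hahn_coefSn hu (ltn_ord i : (i <= n)%N).
have v0 : 2 * n%:R + al + c - N != 0.
  by have := hu0 (n + n); congr (_ != 0); rewrite natrD; ring.
have v1 : 2 * n%:R + al + c - N + 1 != 0.
  by have := hu0 (n + n).+1; congr (_ != 0); rewrite -natr1 natrD; ring.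
move: (hahn_coef _ _ _ _ _) (hahn_coef _ _ _ _ _) => H0 H1 E.
have E' : (n%:R + 1 - i%:R) * H1 = d * (n%:R + i%:R + al + c - N) * H0.
  apply: (mulfI (mulf_neq0 v0 v1)); rewrite /d.
  transitivity ((n%:R + 1 - i%:R) * (2 * n%:R + al + c - N) *
     (2 * n%:R + al + c - N + 1) * H1); first ring.
  by rewrite E; field; rewrite v0 v1.
apply/eqP; rewrite -subr_eq0; apply/eqP.
transitivity (d * (n%:R + i%:R + al + c - N) * H0 - (n%:R + 1 - i%:R) * H1).
  by rewrite -natr1; ring.
by rewrite E' subrr.
Qed.

End Ladder.

Lemma nabla_comp p (a : R) : nabla p \Po ('X - a%:P) = nabla (p \Po ('X - a%:P)).
Proof. by rewrite /nabla rmorphB /= shift_comp. Qed.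

(** The reflection of hahn_ladder_X. *)
Lemma hahn_ladder al c N n (hu0 : forall m : nat, al + c - N + m%:R != 0) :
  let d := ladder_coef al c N n.+1 in
  ('X - al%:P) * nabla (hahn al c N n.+1 + d *: hahn al c N n) =
  n.+1%:R *: hahn al c N n.+1
  - ((n%:R + al + c - N) * d) *: hahn al c N n.
Proof.
move=> d.
have hu (m : nat) : al + c - N + m.+1%:R != 0 by exact: hu0.
have hu0' (m : nat) : - al + (al + c) - (N - al) + m%:R != 0.
  by have := hu0 m; congr (_ != 0); ring.
have := hahn_ladder_X hu0' n => /= /(congr1 (comp_poly ('X - al%:P))).
rewrite comp_polyM comp_polyX nabla_comp !(comp_polyD, comp_polyZ, comp_polyB).
rewrite -!hahn_reflection//.
have -> : (n%:R + 1) * (n%:R + 1 - (N - al)) * (n%:R + (al + c)) /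
  ((2 * n%:R + - al + (al + c) - (N - al)) *
    (2 * n%:R + - al + (al + c) - (N - al) + 1)) = d.
  rewrite /d /ladder_coef -natr1.
  congr (_ / _); ring.
have -> : n%:R + - al + (al + c) - (N - al) = n%:R + al + c - N by ring.
by rewrite rmorphN /= comp_polyZ -hahn_reflection.
Qed.

End Reflection.

(** * Pearson equations and orthogonality of the Hahn polynomials *)

Section Pearson.
Context {R : realType}.
Implicit Types (A B p r : {poly R}) (al c N s : R) (n : nat).
Implicit Types (L : {scalar {poly R}}).

Lemma polymul_functional_is_linear A L : scalar (polymul_functional A L).
Proof. by move=> a p r; rewrite /polymul_functional mulrDr -scalerAr linearP. Qed.

HB.instance Definition _ A L :=
  GRing.isLinear.Build R {poly R} R *%R (polymul_functional A L)
    (polymul_functional_is_linear A L).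

Lemma shift_functional_is_linear L s : scalar (shift_functional L s).
Proof. by move=> a p r; rewrite /shift_functional !linearP. Qed.

HB.instance Definition _ L s :=
  GRing.isLinear.Build R {poly R} R *%R (shift_functional L s)
    (shift_functional_is_linear L s).

Definition pearson A B (L : {poly R} -> R) : Prop :=
  forall p, L (A * shift_op (-1) p) = L (B * p).

Definition hahn_right c N : {poly R} := ('X + c%:P) * ('X - (N - 1)%:P).

Definition hahn_pearson al c N (L : {poly R} -> R) : Prop :=
  pearson ('X * ('X - al%:P)) (hahn_right c N) L.

Lemma shift_opK p : shift_op (-1) (shift_op 1 p) = p.
Proof. by rewrite shift_opD addNr shift_op0. Qed.

Section Orthogonality.
Variables (al c N : R) (L : {scalar {poly R}}).
Hypothesis LP : hahn_pearson al c N L.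

Lemma pearson_hahn_op p r : L (hahn_op al c N p * r) =
  L (hahn_right c N * (p * shift_op 1 r + shift_op 1 p * r)
     + (- 2 *: 'X^2 + (al - c + N - 1) *: 'X + (al + N * (c - 1) - 1)%:P) * (p * r)).
Proof.
have E : L ('X * ('X - al%:P) * (shift_op (-1) p * r)) =
    L (hahn_right c N * (p * shift_op 1 r)).
  by rewrite -LP rmorphM /= shift_opK.
set M := _ + _ + _%:P.
transitivity (L ('X * ('X - al%:P) * (shift_op (-1) p * r)) +
    L (M * (p * r) + hahn_right c N * (shift_op 1 p * r))).
  by rewrite -linearD; congr (L _); rewrite /hahn_op -/M /hahn_right; ring.
by rewrite E -linearD; congr (L _); ring.
Qed.

Lemma hahn_op_sym p r : L (hahn_op al c N p * r) = L (p * hahn_op al c N r).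
Proof. by rewrite [p * _]mulrC !pearson_hahn_op; congr (L _); ring. Qed.

(** Summation by parts: the Dirichlet form of the Hahn operator. *)
Lemma hahn_op_energy p : L ((hahn_op al c N p - theta al c N 0 *: p) * p) =
  - L (hahn_right c N * (shift_op 1 p - p) ^+ 2).
Proof.
have E1 : L ('X * ('X - al%:P) * (shift_op (-1) p * p)) =
    L (hahn_right c N * (p * shift_op 1 p)).
  by rewrite -LP rmorphM /= shift_opK.
have E2 : L ('X * ('X - al%:P) * (p * p)) =
    L (hahn_right c N * (shift_op 1 p * shift_op 1 p)).
  by rewrite -LP !rmorphM /= shift_opK.
rewrite hahn_opE -mul_polyC addrK.
rewrite (_ : _ * p = 'X * ('X - al%:P) * (shift_op (-1) p * p)
   - 'X * ('X - al%:P) * (p * p)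
   + hahn_right c N * ((shift_op 1 p - p) * p)); last by rewrite /hahn_right; ring.
rewrite linearD linearB /= E1 E2 -linearB -linearD -linearN; congr (L _).
ring.
Qed.

Hypothesis hu : forall m : nat, al + c - N + m.+1%:R != 0.

Lemma hahn_orth n m : n != m -> L (hahn al c N n * hahn al c N m) = 0.
Proof.
move=> nm; have := hahn_op_sym (hahn al c N n) (hahn al c N m).
rewrite !hahn_eigen// -scalerAl -scalerAr !linearZ /= => /eqP.
by rewrite -subr_eq0 -mulrBl mulf_eq0 (negbTE (theta_inj hu nm)) => /eqP.
Qed.

Lemma hahn_orth_lt n p : (size p <= n)%N -> L (hahn al c N n * p) = 0.
Proof.
move: p; apply: (graded_ind (size_hahn al c N) (P := fun r => L (hahn al c N n * r) = 0)).
  by rewrite mulr0 linear0.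
move=> a i r lin IH; rewrite mulrDr -scalerAr linearP /= IH addr0.
by rewrite hahn_orth ?mulr0// gtn_eqF.
Qed.

End Orthogonality.

(** The weight (x + c)(x - N + 1) in the Dirichlet form leads to a functional of
    the same family, which allows induction on the degree. *)
Lemma hahn_pearson_right al c N L : hahn_pearson al c N L ->
  hahn_pearson al (c + 1) (N - 1) (polymul_functional (hahn_right c N) L).
Proof.
move=> LP p; rewrite /polymul_functional mulrCA mulrA.
have -> : 'X * ('X - al%:P) * hahn_right c N * shift_op (-1) p =
    'X * ('X - al%:P) * shift_op (-1) (shift_op 1 (hahn_right c N) * p).
  by rewrite [in RHS]rmorphM /= shift_opK; ring.
rewrite LP; congr (L (_ * (_ * _))).
rewrite /hahn_right rmorphM rmorphD rmorphB /= !shift_opX !shift_opC; ring.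
Qed.

(** The Pearson equation for p = 1 and p = x determines the first and the second
    moment in terms of the total mass. *)
Lemma hahn_pearson_right_mass al c N L : hahn_pearson al c N L ->
  (al + c - N + 1) * (al + c - N + 2) * L (hahn_right c N) =
  (N - 1) * (N - 1 - al) * c * (al + c) * L 1.
Proof.
move=> LP; pose m1 := L 'X; pose m2 := L 'X^2; pose m0 := L 1; pose m3 := L 'X^3.
have E1 := LP 1; have E2 := LP 'X.
rewrite shift_opX rmorph1 /hahn_right in E1 E2 *.
have E3 : - al * m1 = (c - N + 1) * m1 - c * (N - 1) * m0.
  apply: (addrI m2); transitivity (L ('X * ('X - al%:P) * 1)).
    rewrite /m1 /m2 -linearZ -linearD; congr (L _).
    by rewrite -mul_polyC; ring.
  rewrite E1 /m1 /m2 /m0 -!linearZ -linearB -linearD; congr (L _).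
  by rewrite -!mul_polyC; ring.
have E4 : - (al + 1) * m2 + al * m1 = (c - N + 1) * m2 - c * (N - 1) * m1.
  apply: (addrI m3); transitivity (L ('X * ('X - al%:P) * ('X + ((-1)%:~R)%:P))).
    rewrite /m1 /m2 /m3 -!linearZ -!linearD; congr (L _).
    by rewrite -!mul_polyC; ring.
  rewrite E2 /m1 /m2 /m3 -!linearZ -linearB -linearD; congr (L _).
  by rewrite -!mul_polyC; ring.
have -> : L (('X + c%:P) * ('X - (N - 1)%:P)) =
    m2 + (c - N + 1) * m1 - c * (N - 1) * m0.
  rewrite /m1 /m2 /m0 -!linearZ -linearD -linearB; congr (L _).
  by rewrite -!mul_polyC; ring.
rewrite -/m0.
have {}E3 : (al + c - N + 1) * m1 = c * (N - 1) * m0.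
  apply/eqP; rewrite -subr_eq0; apply/eqP; move/eqP: E3; rewrite -subr_eq0 => /eqP E3.
  by rewrite -oppr0 -E3; ring.
have {}E4 : (al + c - N + 2) * m2 = (al + c * (N - 1)) * m1.
  apply/eqP; rewrite -subr_eq0; apply/eqP; move/eqP: E4; rewrite -subr_eq0 => /eqP E4.
  by rewrite -oppr0 -E4; ring.
(* The relations E4 and E3 are used in turn, without solving for the moments. *)
transitivity ((al + c - N + 1) * ((al + c - N + 2) * m2)
  + (al + c - N + 2) * (c - N + 1) * ((al + c - N + 1) * m1)
  - (al + c - N + 1) * (al + c - N + 2) * (c * (N - 1) * m0)); first by ring.
rewrite E4.
transitivity ((al + c * (N - 1) + (al + c - N + 2) * (c - N + 1))
    * ((al + c - N + 1) * m1)
  - (al + c - N + 1) * (al + c - N + 2) * (c * (N - 1) * m0)); first by ring.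
rewrite E3; ring.
Qed.

(** By hahn_op_energy and hahn_delta the norm of h_(n+1) is a non-zero multiple of
    the norm of h_n for the parameters (al, c + 1, N - 1), and by
    hahn_pearson_right_mass the new total mass is non-zero.  Each step lowers N by
    one and needs N <> 1, so for a positive integer N this reaches the degrees up
    to N - 1. *)
Lemma hahn_norm_neq0 n al c N L : hahn_pearson al c N L ->
  (forall m : nat, al + c - N + m.+1%:R != 0) ->
  (forall m : nat, al - N + 1 + m%:R != 0) ->
  (forall m : nat, al + c + m%:R != 0) ->
  (forall m : nat, c + m%:R != 0) ->
  (forall i : nat, (0 < i <= n)%N -> N != i%:R) ->
  L 1 != 0 -> L (hahn al c N n * hahn al c N n) != 0.
Proof.
elim: n al c N L => [|n IH] al c N L LP hu haN hac hc hN L1.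
  by rewrite hahn0 mul1r.
have En := hahn_op_energy LP (hahn al c N n.+1).
rewrite hahn_eigen// -scalerBl -scalerAl linearZ /= hahn_delta in En.
have t0 := theta_inj hu (isT : n.+1 != 0%N).
apply: contra_neq (_ : polymul_functional (hahn_right c N) L
   (hahn al (c + 1) (N - 1) n * hahn al (c + 1) (N - 1) n) != 0) => [L0|].
  move: En; rewrite L0 mulr0 exprZn -scalerAr linearZ /= => /esym/eqP.
  by rewrite oppr_eq0 mulf_eq0 expf_eq0 /= pnatr_eq0 /= expr2 => /eqP.
apply: IH.
- exact: hahn_pearson_right.
- by move=> m; have := hu m.+2; congr (_ != 0); rewrite -!natr1; ring.
- by move=> m; have := haN m.+1; congr (_ != 0); rewrite -!natr1; ring.
- by move=> m; have := hac m.+1; congr (_ != 0); rewrite -!natr1; ring.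
- by move=> m; have := hc m.+1; congr (_ != 0); rewrite -!natr1; ring.
- move=> i /andP[i0 iln]; have := hN i.+1 iln; apply: contra => /eqP NE.
  by rewrite -natr1 -NE subrK.
- apply/eqP => L10; have L0 : L (hahn_right c N) = 0.
    by rewrite -[hahn_right c N]mulr1; exact: L10.
  have := hahn_pearson_right_mass LP; rewrite L0 mulr0 => /esym/eqP.
  rewrite !mulf_eq0 (negbTE L1) orbF.
  have := hc 0; rewrite addr0 => /negbTE ->; have := hac 0; rewrite addr0 => /negbTE ->.
  have N1 := hN 1%N isT; rewrite subr_eq0 (negbTE N1) /= orbF.
  rewrite orbF; apply/negP; have := haN 0; apply: contra => /eqP e; apply/eqP; rewrite addr0.
  rewrite -oppr0 -e; ring.
Qed.

End Pearson.

(** * The chain of Pearson functionals above the Geronimus transform *)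

Section Geronimus.
Context {R : realType}.
Implicit Types (p : {poly R}) (al c N s : R) (n j k : nat).
Implicit Types (L : {scalar {poly R}}).

(** The Pearson equation of the Hahn functional with the zero x = 0 of its left
    coefficient moved to x = - s: for a measure and a natural number s, the
    support is extended by the points - 1, ..., - s. *)
Definition shifted_pearson al c N s (L : {poly R} -> R) : Prop :=
  pearson (('X + s%:P) * ('X - al%:P)) (hahn_right c N) L.

Lemma shifted_pearson_step al c N s L : shifted_pearson al c N (s + 1) L ->
  shifted_pearson al c N s (polymul_functional ('X + (s + 1)%:P) L).
Proof.
move=> LP p; rewrite /polymul_functional.
rewrite (_ : _ * _ = ('X + (s + 1)%:P) * ('X - al%:P) *
   shift_op (-1) (('X + (s + 1)%:P) * p)).
  by rewrite LP; congr (L _); ring.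
rewrite [shift_op _ (_ * _)]rmorphM /= [shift_op _ (_ + _)]rmorphD /= shift_opX shift_opC.
ring.
Qed.

Lemma shifted_pearson0 al c N L :
  shifted_pearson al c N 0 L -> hahn_pearson al c N L.
Proof. by rewrite /shifted_pearson /hahn_pearson addr0. Qed.

(** Moving the zero by s breaks the symmetry of the Hahn operator by a term that is
    linear in s: the functional no longer kills the range of the operator
    hahn_op - theta 0. *)
Lemma hahn_op_nabla al c N s L p : shifted_pearson al c N s L ->
  L (hahn_op al c N p - theta al c N 0 *: p)
    = s * L (('X - al%:P) * nabla p).
Proof.
move=> LP.
have E1 : L (hahn_right c N * shift_op 1 p) = L (('X + s%:P) * ('X - al%:P) * p).
  by rewrite -LP shift_opK.
have E2 := LP p.
rewrite hahn_opE -mul_polyC addrK.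
transitivity (L ('X * ('X - al%:P) * (shift_op (-1) p - p))
   + (L (hahn_right c N * shift_op 1 p) - L (hahn_right c N * p))).
  by rewrite -linearB -linearD; congr (L _); rewrite /hahn_right; ring.
rewrite E1 -E2 -linearB -linearD -linearZ; congr (L _).
rewrite /nabla -!mul_polyC; ring.
Qed.

(** The same value of (x - al) nabla p for the functional (x + s) L, read off from
    the Pearson equation of L itself; the polynomial factors of degree 2 and 1
    cancel and a constant is left. *)
Lemma shifted_pearson_nabla al c N s L p : shifted_pearson al c N s L ->
  L (('X + s%:P) * (('X - al%:P) * nabla p + (al + c - N - s + 1) *: p))
    = (c - s) * (N + s - 1) * L p.
Proof.
move=> LP; have E := LP p.
transitivity (L (('X + s%:P) * ('X - al%:P) * p
    + (al + c - N - s + 1) *: (('X + s%:P) * p))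
   - L (('X + s%:P) * ('X - al%:P) * shift_op (-1) p)).
  by rewrite -linearB; congr (L _); rewrite /nabla -!mul_polyC; ring.
rewrite E -linearB -linearZ; congr (L _); rewrite /hahn_right -!mul_polyC; ring.
Qed.

Section HahnValues.
Variables al c N : R.
Hypothesis hu0 : forall m : nat, al + c - N + m%:R != 0.
Let hu m : al + c - N + m.+1%:R != 0 := hu0 m.+1.

Local Notation h := (hahn al c N).

(** The term in (x - al) nabla h_n is eliminated between hahn_op_nabla, applied to
    (x + s + 1) L, and shifted_pearson_nabla, applied to L.  The factors
    on the right come from n (n + u) + s (u - s) = (n + s)(n + u - s). *)
Lemma hahn_value_step n s L : shifted_pearson al c N (s + 1) L ->
  s * (c - s - 1) * (N + s) * L (h n) =
  (n%:R + s) * (n%:R + al + c - N - s) * L (('X + (s + 1)%:P) * h n).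
Proof.
move=> LP; have E1 := shifted_pearson_nabla (h n) LP.
have := hahn_op_nabla (h n) (shifted_pearson_step LP).
rewrite hahn_eigen// -scalerBl linearZ /= /polymul_functional => E2.
rewrite mulrDr -scalerAr linearD linearZ /= in E1.
rewrite /theta in E2.
set x := L _ in E1 E2; set y := L _ in E1 E2; set z := L _ in E1.
transitivity (s * ((c - (s + 1)) * (N + (s + 1) - 1) * z)); first by rewrite /z; ring.
rewrite -E1 mulrDr -E2; rewrite /y; ring.
Qed.

(** For s = 1 the relation hahn_op_nabla at h_(n+1) + eps h_n, evaluated with the
    ladder relation, has the factor (n + 1)(n + u) in both terms. *)
Lemma hahn_value_ladder n L : shifted_pearson al c N 1 L ->
  L (h n.+1) = - ladder_coef al c N n.+1 * L (h n).
Proof.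
move=> LP; have /= := hahn_ladder n hu0.
move: (ladder_coef _ _ _ _) => d LD.
have := hahn_op_nabla (h n.+1 + d *: h n) LP.
rewrite LD mul1r.
have -> : hahn_op al c N (h n.+1 + d *: h n) =
    theta al c N n.+1 *: h n.+1 + (d * theta al c N n) *: h n.
  by rewrite linearD linearZ /= !hahn_eigen// scalerA.
rewrite scalerDr scalerA => E.
have n0 : n.+1%:R * (n%:R + al + c - N) != 0.
  rewrite mulf_neq0 ?pnatr_eq0//; have := hu0 n; congr (_ != 0); ring.
apply: (mulfI n0); move: E.
rewrite !(linearD, linearN, scalarZ) /=.
set x := L _; set y := L _ => E.
apply/eqP; rewrite -subr_eq0; apply/eqP; move/eqP: E; rewrite -subr_eq0 => /eqP E.
rewrite -E /theta -natr1. ring.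
Qed.

End HahnValues.

(** (x + j + 1) ... (x + k + 1) nu: from the functional nu itself, for j = k + 1,
    down to a functional of the Hahn class, for j = 0. *)
Definition chain k (nu : {poly R} -> R) j : {poly R} -> R :=
  polymul_functional (poch ('X + j.+1%:R) (k.+1 - j)) nu.

Variables (k : nat) (al c N : R) (nu : {scalar {poly R}}).
Hypothesis nuP : shifted_pearson al c N (k%:R + 1) nu.
Hypothesis hu0 : forall m : nat, al + c - N + m%:R != 0.

Local Notation h := (hahn al c N).

HB.instance Definition _ j := GRing.Linear.copy (chain k nu j)
  (polymul_functional (poch ('X + j.+1%:R) (k.+1 - j)) nu).

Lemma chain_top p : chain k nu k.+1 p = nu p.
Proof. by rewrite /chain /polymul_functional subnn poch0 mul1r. Qed.

Lemma chain_step j p : (j <= k)%N ->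
  chain k nu j p = chain k nu j.+1 (('X + (j.+1%:R)%:P) * p).
Proof.
move=> jk; rewrite /chain /polymul_functional subSn// pochSl subSS.
congr (nu _); rewrite -!natr1; rewrite -addrA.
have -> : (j%:R + 1)%:P = j%:R + 1 :> {poly R} by rewrite rmorphD rmorph1 rmorph_nat.
ring.
Qed.

Lemma chain_pearson j : (j <= k.+1)%N -> shifted_pearson al c N j%:R (chain k nu j).
Proof.
move=> jk; rewrite -(subKn jk).
elim: (k.+1 - j)%N (leq_subr j k.+1) => [|i IH] ik.
  by move=> p; rewrite subn0 !chain_top -natr1; exact: nuP.
have ji : (k.+1 - i = (k.+1 - i.+1).+1)%N by rewrite -subSn.
move: (IH (ltnW ik)); rewrite ji; set m := (k.+1 - i.+1)%N.
have mk : (m <= k)%N by rewrite /m subSS leq_subr.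
rewrite -natr1 => /shifted_pearson_step H p.
by rewrite !(chain_step _ mk) -natr1; exact: H.
Qed.

Lemma dual_basis_theta n j : (dual_basis al c N j).[theta al c N n] =
  (-1) ^+ j * \prod_(i < j) ((n%:R + 1 + i%:R) * (n%:R + al + c - N - 1 - i%:R)).
Proof.
rewrite /dual_basis hornerZ horner_prod; congr (_ * _); apply: eq_bigr => i _.
rewrite hornerD hornerX hornerC /theta; ring.
Qed.

(** hahn_value_step, iterated from chain 1; written without quotients, the product
    of the factors is a dual basis polynomial at theta n. *)
Lemma chain_value n j : (j <= k)%N ->
  j`!%:R * poch (2 - c) j * poch (N + 1) j * chain k nu j.+1 (h n) =
  (dual_basis al c N j).[theta al c N n] * chain k nu 1 (h n).
Proof.
rewrite dual_basis_theta; elim: j => [|j IH] jk.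
  by rewrite !poch0 big_ord0 fact0 expr0 !mul1r.
rewrite !pochS factS natrM exprS big_ord_recr /=.
have jP : shifted_pearson al c N (j.+1%:R + 1) (chain k nu j.+2).
  by rewrite natr1; apply: chain_pearson.
have E : j.+1%:R * (c - j.+1%:R - 1) * (N + j.+1%:R) * chain k nu j.+2 (h n) =
    (n%:R + j.+1%:R) * (n%:R + al + c - N - j.+1%:R) * chain k nu j.+1 (h n).
  rewrite (chain_step _ jk) -[j.+2%:R]natr1.
  by have := hahn_value_step hu0 n jP.
transitivity (- (j`!%:R * poch (2 - c) j * poch (N + 1) j *
  (j.+1%:R * (c - j.+1%:R - 1) * (N + j.+1%:R) * chain k nu j.+2 (h n)))).
  by rewrite -natr1; ring.
rewrite E.
transitivity (- ((n%:R + j.+1%:R) * (n%:R + al + c - N - j.+1%:R)) *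
  (j`!%:R * poch (2 - c) j * poch (N + 1) j * chain k nu j.+1 (h n))); first ring.
rewrite IH ?(ltnW jk)// -natr1; ring.
Qed.

Definition geronimus : {poly R} -> R := polymul_functional (poch ('X + 1) k) nu.

Lemma geronimus_chain p : geronimus p =
  \sum_(j < k.+1) poch (- k%:R) j * chain k nu j.+1 p.
Proof.
rewrite /geronimus /polymul_functional poch_expand mulr_suml linear_sum.
apply: eq_bigr => j _; rewrite /chain /polymul_functional subSS.
rewrite -scalarZ -mul_polyC mulrA; congr (nu (_ * _ * _)).
by rewrite (poch_rmorph polyC) rmorphN /= rmorph_nat.
Qed.

Lemma dual_hahn2_horner x : (dual_hahn2 al c N k).[x] =
  \sum_(j < k.+1) dual_coef c N k j / j`!%:R * (dual_basis al c N j).[x].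
Proof.
by rewrite /dual_hahn2 horner_sum; apply: eq_bigr => j _; rewrite hornerZ.
Qed.

Lemma gamma0 : gamma al c N k 0 = poch (2 - c) k * poch (N + 1) k.
Proof.
rewrite /gamma dual_hahn2_horner mul0r big_ord_recl big1 => [|i _].
  rewrite /dual_coef /dual_basis /= poch0 big_ord0 fact0 hornerZ hornerC.
  by rewrite subn0 !addr0 divr1 expr0 !mulr1 mul1r.
rewrite /dual_basis hornerZ horner_prod big_ord_recl /=.
by rewrite hornerD hornerX hornerC !mul0r addr0 mul0r !mulr0.
Qed.

Lemma gamma_theta n : gamma al c N k n.+1 = (dual_hahn2 al c N k).[theta al c N n].
Proof. by rewrite /gamma /theta; congr (_.[_]); rewrite -natr1; ring. Qed.

(** Each term of geronimus_chain is a multiple of chain 1 by chain_value, and the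
    sum of the factors is the defining sum of the dual Hahn polynomial at theta n,
    divided by gamma 0 = (2 - c)_k (N + 1)_k. *)
Lemma geronimus_value n :
  gamma al c N k 0 * geronimus (h n) = gamma al c N k n.+1 * chain k nu 1 (h n).
Proof.
rewrite gamma0 geronimus_chain gamma_theta dual_hahn2_horner.
rewrite mulr_sumr mulr_suml; apply: eq_bigr => j _.
have jk : (j <= k)%N by rewrite -ltnS.
rewrite (poch_split _ jk) (poch_split (N + 1) jk) /dual_coef.
have E := chain_value n jk.
transitivity (poch (- k%:R) j * poch (2 - c + j%:R) (k - j)
  * poch (N + 1 + j%:R) (k - j) / j`!%:R *
  (j`!%:R * poch (2 - c) j * poch (N + 1) j * chain k nu j.+1 (h n))); last first.
  by rewrite E; ring.
by field; exact: fact_neq0.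
Qed.

End Geronimus.

Lemma hahn_norm_Xn {R : realType} (al c N : R) (L : {scalar {poly R}}) n :
  hahn_pearson al c N L -> (forall m : nat, al + c - N + m.+1%:R != 0) ->
  L (hahn al c N n * 'X^n) = L (hahn al c N n * hahn al c N n).
Proof.
move=> LP hu; rewrite -{1}(subrK (hahn al c N n) 'X^n) mulrDr linearD /=.
rewrite (hahn_orth_lt LP)// ?add0r//.
apply/leq_sizeP => j; rewrite leq_eqVlt => /predU1P[<-|nj].
  by rewrite coefB coefXn eqxx hahn_coef_n subrr.
by rewrite coefB coefXn gtn_eqF// nth_default ?subr0// size_hahn.
Qed.

(** * Orthogonality for the Geronimus transform *)

Section GeronimusOrthogonality.
Context {R : realType}.
Implicit Types (p : {poly R}) (n j : nat).

Variables (k : nat) (al c N : R) (nu : {scalar {poly R}}).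
Hypothesis nuP : shifted_pearson al c N (k%:R + 1) nu.
Hypothesis hu0 : forall m : nat, al + c - N + m%:R != 0.
Let hu m : al + c - N + m.+1%:R != 0 := hu0 m.+1.

Local Notation h := (hahn al c N).
Local Notation rho := (chain k nu 0).

Lemma chain0_hahn_pearson : hahn_pearson al c N rho.
Proof.
have : shifted_pearson al c N 0 (chain k nu 0) by exact: chain_pearson.
exact: shifted_pearson0.
Qed.

(** Relates the total masses without dividing by al + c - N - j, which may vanish.
    If c <> j + 1, N <> - j and the mass of chain j.+1 is non-zero, then so is that
    of chain j; for j = 0 there is also the converse. *)
Lemma chain_mass_step j : (j <= k)%N ->
  (al + c - N - j%:R) * chain k nu j 1
    = (c - j.+1%:R) * (N + j%:R) * chain k nu j.+1 1.
Proof.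
move=> jk; have jP : shifted_pearson al c N j.+1%:R (chain k nu j.+1).
  by apply: chain_pearson.
have := shifted_pearson_nabla 1 jP.
have -> : nabla (1 : {poly R}) = 0 by rewrite /nabla rmorph1 subrr.
rewrite mulr0 add0r -scalerAr scalarZ (chain_step nu 1 jk) -natr1.
rewrite (_ : al + c - N - (j%:R + 1) + 1 = al + c - N - j%:R); last by ring.
by rewrite (_ : N + (j%:R + 1) - 1 = N + j%:R); last by ring.
Qed.

(** This is what makes geronimus a Geronimus transform of chain 0. *)
Lemma chain0_geronimus p : rho p = geronimus k nu (('X + (k%:R + 1)%:P) * p).
Proof.
rewrite /chain /geronimus /polymul_functional subn0 pochS mulrA; congr (nu (_ * _ * _)).
rewrite rmorphD /= polyC1 rmorph_nat; ring.
Qed.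

HB.instance Definition _ := GRing.Linear.copy (geronimus k nu)
  (polymul_functional (poch ('X + 1) k) nu).

Hypothesis hgamma : forall n, gamma al c N k n != 0.

(** By geronimus_value and hahn_value_ladder the two terms of q are opposite
    multiples of chain 1 at h_n. *)
Lemma q_mass n : geronimus k nu (q al c N k n.+1) = 0.
Proof.
apply: (mulfI (hgamma 0)); rewrite mulr0 /q linearD scalarZ /= mulrDr mulrCA.
rewrite !geronimus_value// (hahn_value_ladder hu0 n); last exact: (chain_pearson nuP).
have -> : beta al c N k n.+1 =
  ladder_coef al c N n.+1 * (gamma al c N k n.+2 / gamma al c N k n.+1) by [].
have := hgamma n.+1; move: (ladder_coef _ _ _ _) => d g0.
by field.
Qed.

(** From x^m to x^(m+1): multiplication by x + k + 1 leads to chain 0, for which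
    h_(n+1) and h_n are both orthogonal to x^m as long as m < n. *)
Lemma q_moment n m : (m <= n)%N -> geronimus k nu (q al c N k n.+1 * 'X^m) = 0.
Proof.
elim: m => [|m IH] mn; first by rewrite expr0 mulr1 q_mass.
have -> : q al c N k n.+1 * 'X^(m.+1) =
   ('X + (k%:R + 1)%:P) * (q al c N k n.+1 * 'X^m)
   - (k%:R + 1) *: (q al c N k n.+1 * 'X^m) :> {poly R} by rewrite exprS -mul_polyC; ring.
rewrite linearB scalarZ /= IH ?(ltnW mn)// mulr0 subr0 -chain0_geronimus.
rewrite /q mulrDl linearD -scalerAl scalarZ /=.
have L0 := chain0_hahn_pearson.
by rewrite !(hahn_orth_lt L0)// ?size_polyXn ?ltnS ?(ltnW mn)// mulr0 addr0.
Qed.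

Lemma q_norm n : geronimus k nu (q al c N k n.+1 * 'X^(n.+1)) =
  beta al c N k n.+1 * rho (h n * h n).
Proof.
have -> : q al c N k n.+1 * 'X^(n.+1) =
   ('X + (k%:R + 1)%:P) * (q al c N k n.+1 * 'X^n)
   - (k%:R + 1) *: (q al c N k n.+1 * 'X^n) :> {poly R} by rewrite exprS -mul_polyC; ring.
rewrite linearB scalarZ /= q_moment// mulr0 subr0 -chain0_geronimus.
rewrite /q mulrDl linearD -scalerAl scalarZ /=.
rewrite (hahn_orth_lt chain0_hahn_pearson)// ?size_polyXn//.
by rewrite add0r (hahn_norm_Xn _ chain0_hahn_pearson hu).
Qed.

Lemma size_q n : size (q al c N k n) = n.+1.
Proof.
case: n => [|n] /=; first by rewrite size_poly1.
rewrite size_polyDl ?size_hahn//.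
by rewrite (leq_ltn_trans (size_scale_leq _ _))// size_hahn.
Qed.

Hypothesis haN : forall m : nat, al - N + 1 + m%:R != 0.
Hypothesis hac : forall m : nat, al + c + m%:R != 0.

Lemma beta_neq0 n : beta al c N k n.+1 != 0.
Proof.
rewrite /beta !mulf_neq0 ?invr_eq0 ?hgamma ?pnatr_eq0//.
- by have := haN n; congr (_ != 0); rewrite -natr1; ring.
- by have := hac n; congr (_ != 0); rewrite -natr1; ring.
- rewrite mulf_neq0//.
    by have := hu0 (n + n).+1; congr (_ != 0); rewrite -!natr1 natrD; ring.
  by have := hu0 (n + n); congr (_ != 0); rewrite -!natr1 natrD; ring.
Qed.

(** In degree n + 1 only the norm of h_n enters, so for a measure on N points the
    family reaches the degree N. *)
Lemma geronimus_orthogonal (I : pred nat) :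
  chain k nu 1 1 != 0 ->
  (forall n, I n.+1 -> rho (h n * h n) != 0) ->
  orthogonal_polys (geronimus k nu) I (q al c N k).
Proof.
move=> nu1 norm_neq0 [|n] In; split; rewrite ?size_q//.
- rewrite /= mulr1; apply/eqP => rho0.
  have := geronimus_value nuP hu0 0; rewrite hahn0 rho0 mulr0 => /esym/eqP.
  by rewrite mulf_eq0 (negbTE (hgamma 1)) (negbTE nu1).
- by move=> m; rewrite ltnS; exact: q_moment.
- by rewrite q_norm mulf_neq0 ?beta_neq0 ?norm_neq0.
Qed.

End GeronimusOrthogonality.

(** * The Hahn functional and the Hahn measure *)

Section Existence.
Context {R : realType}.
Implicit Types (al c N : R).

Lemma polymul_fbasis_right c N j :
  hahn_right c N * fbasis j =
  ((j%:R + 1 - N) * (j%:R + c)) *: fbasis j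
  - ((j%:R + 1 - N) + (j%:R + 1 + c)) *: fbasis j.+1 + fbasis j.+2 :> {poly R}.
Proof.
rewrite /hahn_right !fbasisS -!mul_polyC -!natr1; ring.
Qed.

(** On the basis of falling factorials the Pearson equation is a two-term
    recurrence for the moments, the terms in fbasis j.+2 being equal on both
    sides. *)
Lemma hahn_pearson_functional al c N (m0 : R) :
  (forall m : nat, al + c - N + m.+1%:R != 0) ->
  exists2 L : {scalar {poly R}}, hahn_pearson al c N L & L 1 = m0.
Proof.
move=> hu.
pose fix m j : R := if j is i.+1 then
  (i%:R + 1 - N) * (i%:R + c) / (al + c - N + i.+1%:R) * m i else m0.
have [L LE] := graded_functional (@size_fbasis R) m.
exists L; last by rewrite -(fbasis0 (R := R)) LE.
suff : (polymul_functional ('X * ('X - al%:P)) L \o shift_op (-1)) =1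
   polymul_functional (hahn_right c N) L by [].
apply: (graded_eq (@size_fbasis R)) => j.
rewrite /= /polymul_functional polymul_fbasis_right.
have -> : 'X * ('X - al%:P) * shift_op (-1) (fbasis j) =
   (al - (j%:R + 1)) *: fbasis j.+1 + fbasis j.+2.
  rewrite [_ * (_ - _)]mulrC -mulrA X_shift_fbasis.
  rewrite !fbasisS -!mul_polyC -!natr1; ring.
rewrite !linearD linearN !scalarZ /= !LE /= -!natr1.
have := hu j; have := hu j.+1; rewrite -!natr1 => uj1 uj.
by field; rewrite uj uj1.
Qed.

(** A functional that solves the Pearson equation makes the Hahn polynomials
    orthogonal, so the set in the definition is not empty; and an element of that
    set is determined by its values on the Hahn polynomials. *)
Lemma hahn_functional_generic al c N : hahn_generic al c N ->
  exists2 L : {scalar {poly R}}, hahn_pearson al c N L &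
    (hahn_functional al c N = L) /\ L 1 != 0.
Proof.
move=> /and5P[hN hu haN hac hc].
have {}haN := nonposint_addn_neq0 haN; have {}hac := nonposint_addn_neq0 hac.
have {}hc := nonposint_addn_neq0 hc.
have hu' (m : nat) : al + c - N + m.+1%:R != 0.
  by have := nonposint_addn_neq0 hu m; congr (_ != 0); rewrite -natr1; ring.
have mass_neq0 : hahn_mass al c N != 0.
  have g1 : Gamma (al + 1 - N) != 0.
    by apply: Gamma_neq0 => m; have := haN m; congr (_ != 0); ring.
  have g2 : Gamma (al + c + 1 - N) != 0.
    by apply: Gamma_neq0 => m; have := nonposint_addn_neq0 hu m; congr (_ != 0); ring.
  have := Gamma_neq0 hc; have := Gamma_neq0 hac; rewrite /hahn_mass.
  move: (Gamma _) (Gamma _) (Gamma _) (Gamma _) g1 g2 => A B C D A0 D0 B0 C0.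
  by rewrite !mulf_neq0 ?invr_eq0.
have [L LP L1] := hahn_pearson_functional (hahn_mass al c N) hu'.
have hNi (i : nat) : (0 < i)%N -> N != i%:R.
  move=> i0; apply: contra hN => /eqP ->; rewrite /posint ltr0n i0 andbT.
  exact: natr_nat.
exists L => //; split; last by rewrite L1.
rewrite /hahn_functional (negbTE hN).
set S := [set mu | _].
have SL : S L.
  split; [by move=> a p r; rewrite linearP| |by []].
  move=> n _; split; first exact: size_hahn.
    by move=> m mn; rewrite (hahn_orth_lt LP)// size_polyXn.
  rewrite (hahn_norm_Xn _ LP hu').
  by apply: (hahn_norm_neq0 LP) => //; [move=> i /andP[/hNi] | rewrite L1].
have [] := xgetPex (fun=> 0) (ex_intro _ _ SL).
rewrite -/S; set mu := xget _ _ => mu_lin mu_orth mu1.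
pose M : {scalar {poly R}} := HB.pack mu (GRing.isLinear.Build _ _ _ _ mu mu_lin).
suff : M =1 L by move=> ML; apply/funext.
apply: (graded_eq (size_hahn al c N)) => -[|n].
  by rewrite hahn0 L1; exact: mu1.
have [_ /(_ 0%N isT) + _] := mu_orth n.+1 isT; rewrite expr0 mulr1 => E.
rewrite [LHS]E; have := hahn_orth_lt LP hu' (n := n.+1) (p := 1).
by rewrite mulr1 size_poly1 => ->.
Qed.

Definition hahn_weight al c N (x : nat) : R :=
  Gamma (al - x%:R) * Gamma (x%:R + c) / (Gamma (N - x%:R) * x`!%:R).

Section Measure.
Variables (K : nat) (al c : R).
Let N : R := K%:R.
Hypothesis haN : forall m : nat, al - N + 1 + m%:R != 0.
Hypothesis hc : forall m : nat, c + m%:R != 0.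

Let al_regular x (m : nat) : (x < K)%N -> al - x%:R + m%:R != 0.
Proof.
move=> xK; have := haN (K - x.+1 + m); rewrite natrD natrB// -natr1.
by congr (_ != 0); rewrite /N; ring.
Qed.

Lemma hahn_weight_ratio x : (x.+1 < K)%N ->
  hahn_weight al c N x.+1 * ((x%:R + 1) * (x%:R + 1 - al)) =
  hahn_weight al c N x * ((x%:R + c) * (x%:R - (N - 1))).
Proof.
move=> xK; rewrite /hahn_weight.
have G1 : Gamma (al - x%:R) = (al - x.+1%:R) * Gamma (al - x.+1%:R).
  rewrite -Gamma_recur => [|m]; last exact: al_regular.
  by congr Gamma; rewrite -natr1; ring.
have G2 : Gamma (x.+1%:R + c) = (x%:R + c) * Gamma (x%:R + c).
  rewrite -Gamma_recur => [|m]; last first.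
    by have := hc (x + m); rewrite natrD; congr (_ != 0); ring.
  by congr Gamma; rewrite -natr1; ring.
have N0 : 0 < N - x.+1%:R by rewrite subr_gt0 ltr_nat.
have G3 : Gamma (N - x%:R) = (N - x.+1%:R) * Gamma (N - x.+1%:R).
  rewrite -Gamma_recur_pos//.
  by congr Gamma; rewrite -natr1; ring.
have g0 : Gamma (N - x.+1%:R) != 0 by rewrite gt_eqF// Gamma_gt0.
rewrite G1 G2 G3 factS natrM.
move: (Gamma _) (Gamma _) (Gamma _) g0 => A B C A0.
have x1 : x%:R + 1 != 0 :> R by rewrite natr1.
have := gt_eqF N0; rewrite -!natr1 => /negbT N1.
by field; rewrite A0 fact_neq0 x1 N1.
Qed.

Lemma horner_shift (l : int) (p : {poly R}) x :
  (shift_op l p).[x] = p.[x + l%:~R].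
Proof. by rewrite horner_comp hornerD hornerX hornerC. Qed.

(** The Pearson equation is a translation of the summation index; no boundary
    terms appear, since one coefficient vanishes at x = 0 and the other one at
    x = N - 1. *)
Lemma hahn_functional_measure : (0 < K)%N ->
  exists2 L : {scalar {poly R}}, hahn_pearson al c N L &
    hahn_functional al c N = L /\
    forall p, L p = Gamma N * \sum_(x < K) hahn_weight al c N x * p.[x%:R].
Proof.
move=> K0.
pose W (p : {poly R}) := Gamma N * \sum_(x < K) hahn_weight al c N x * p.[x%:R].
have W_lin : scalar W.
  move=> a p r; rewrite /W mulrCA -mulrDr; congr (_ * _).
  rewrite mulr_sumr -big_split; apply: eq_bigr => x _ /=.
  by rewrite hornerD hornerZ; ring.
exists (HB.pack W (GRing.isLinear.Build _ _ _ _ W W_lin) : {scalar {poly R}}); last first.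
  split=> //=; rewrite /hahn_functional /posint natr_nat ltr0n K0 /=.
  by apply/funext => p; rewrite natrK.
move=> p; rewrite /= /W; congr (_ * _).
have [K' KE] : exists K', K = K'.+1 by exists K.-1; rewrite prednK.
rewrite KE big_ord_recl [RHS]big_ord_recr /=.
rewrite (_ : (_ * shift_op _ p).[0] = 0); last by rewrite !hornerM hornerX !mul0r.
rewrite (_ : (_ * p).[K'%:R] = 0); last first.
  rewrite !hornerM hornerXsubC (_ : K'%:R - (N - 1) = 0) ?mulr0 ?mul0r//.
  by rewrite /N KE -natr1; ring.
rewrite !mulr0 add0r addr0; apply: eq_bigr => i _.
rewrite /bump /= add1n !hornerM horner_shift !hornerD !hornerN !hornerX !hornerC.
have iK : (i.+1 < K)%N by rewrite KE ltnS.
have E := hahn_weight_ratio iK.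
rewrite -[i.+1%:R]natr1 (_ : i%:R + 1 + -1%:~R = i%:R :> R); last by ring.
rewrite [LHS]mulrA E; ring.
Qed.

End Measure.

(** Moments in the basis adapted to the other end of the support.  For a positive
    integer N the moment of index N - 1 sees the point 0 only, and descending from
    it shows that the total mass is non-zero although the weights may have
    different signs. *)
Lemma mass_lowering al c N (L : {scalar {poly R}}) j : hahn_pearson al c N L ->
  (al + c - N + j.+1%:R) * L (poch ('X - (N - 1)%:P) j.+1) =
  (N - 1 - j%:R) * (N - 1 - j%:R - al) * L (poch ('X - (N - 1)%:P) j).
Proof.
move=> LP; set d := poch _ j.
have sp : shift_op (-1) (poch ('X - (N - 1)%:P + 1) j) = d.
  rewrite poch_rmorph; congr (poch _ j).
  rewrite rmorphD rmorphB rmorph1 /= shift_opX shift_opC; ring.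
have E := LP (poch ('X - (N - 1)%:P + 1) j).
rewrite sp /hahn_right -mulrA -pochSl in E.
rewrite -!scalarZ; apply/eqP; rewrite -subr_eq0 -linearB.
move/esym/eqP: E; rewrite -subr_eq0 -linearB /=; congr (L _ == 0).
rewrite pochS -/d -!mul_polyC -natr1.
have -> : j%:R = (j%:R)%:P :> {poly R} by rewrite rmorph_nat.
ring.
Qed.

End Existence.

(** * The polynomials P1 and P2 *)

Section DualPolynomials.
Context {R : realType}.
Variables (al c N : R) (k : nat).
Implicit Types (n j : nat).

Local Notation r := (dual_basis al c N).
Local Notation th := (theta al c N).

Lemma dual_basisS j : r j.+1 =
  - (r j * ('X + (j%:R * (al + c - N - 2 - j%:R))%:P)).
Proof.
by rewrite /dual_basis exprS big_ord_recr /= -!mul_polyC; ring.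
Qed.

Lemma dual_basis0 : r 0 = 1.
Proof. by rewrite /dual_basis big_ord0 scale1r. Qed.

Lemma size_dual_basis j : size (r j) = j.+1.
Proof.
elim: j => [|j IH]; first by rewrite dual_basis0 size_poly1.
by rewrite dual_basisS size_polyN size_Mmonic ?monicXaddC ?size_XaddC ?IH ?addn2// -size_poly_eq0 IH.
Qed.

Lemma coef_dual_basis j : (r j)`_j = (-1) ^+ j.
Proof.
elim: j => [|j IH]; first by rewrite dual_basis0 coefC expr0.
rewrite dual_basisS mulrDr coefN coefD coefMX /= IH mulrC coefCM.
by rewrite [(r j)`_j.+1]nth_default ?size_dual_basis// mulr0 addr0 exprS mulN1r.
Qed.

Lemma coef_graded_sum (e : nat -> {poly R}) (a : nat -> R) m :
  (forall j, size (e j) = j.+1) ->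
  (\sum_(j < m.+1) a j *: e j)`_m = a m * (e m)`_m
  /\ (size (\sum_(j < m.+1) a j *: e j)%R <= m.+1)%N.
Proof.
move=> se; have sz i : (size (\sum_(j < i) a j *: e j)%R <= i)%N.
  apply: (leq_trans (size_sum _ _ _)); apply/bigmax_leqP => l _.
  by rewrite (leq_trans (size_scale_leq _ _))// se.
split; last exact: sz.
by rewrite big_ord_recr /= coefD [X in X + _]nth_default ?sz// add0r coefZ.
Qed.

Lemma dual_coef_top : dual_coef c N k k = (-1) ^+ k * k`!%:R.
Proof. by rewrite /dual_coef subnn !poch0 !mulr1 poch_opp. Qed.

Lemma coef_P2 : (P2 al c N k)`_k = 1.
Proof.
rewrite /P2 /dual_hahn2 (coef_graded_sum (fun j => dual_coef c N k j / j`!%:R) k size_dual_basis).1.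
by rewrite dual_coef_top mulfK ?fact_neq0// coef_dual_basis -expr2 sqrr_sign.
Qed.

Lemma size_poly_coef (p : {poly R}) m : (size p <= m.+1)%N -> p`_m != 0 -> size p = m.+1.
Proof.
move=> sp pm; apply/eqP; rewrite eqn_leq sp /= ltnNge; apply: contra pm => pm.
by rewrite nth_default.
Qed.

Lemma size_P2 : size (P2 al c N k) = k.+1.
Proof.
apply: size_poly_coef; last by rewrite coef_P2 oner_eq0.
exact: (coef_graded_sum (fun j => dual_coef c N k j / j`!%:R) k size_dual_basis).2.
Qed.

Definition dual_companion : {poly R} :=
  \sum_(j < k.+1) (dual_coef c N k j / (j.+1)`!%:R) *: r j.

Lemma P1_companion : P1 al c N k = (al + c - N) *: P2 al c N k
  + 2 *: (('X - (al + c - N - 1)%:P) * dual_companion).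
Proof. by []. Qed.

Lemma coef_P1 : (P1 al c N k)`_k.+1 = 2 / k.+1%:R.
Proof.
rewrite P1_companion coefD !coefZ [X in _ * X + _]nth_default ?size_P2// mulr0 add0r.
have [S1 S2] := coef_graded_sum (fun j => dual_coef c N k j / (j.+1)`!%:R) k size_dual_basis.
rewrite mulrBl coefB coefXM /= coefCM [dual_companion`_k.+1]nth_default// mulr0 subr0.
rewrite [_`_k]S1 coef_dual_basis dual_coef_top factS natrM.
have k1 : k.+1%:R != 0 :> R by rewrite pnatr_eq0.
transitivity (2 / k.+1%:R * ((-1) ^+ k * (-1) ^+ k) : R).
  by field; rewrite fact_neq0 andbT addrC natr1.
by rewrite -expr2 sqrr_sign mulr1.
Qed.

Lemma size_P1 : size (P1 al c N k) = k.+2.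
Proof.
apply: size_poly_coef; last first.
  by rewrite coef_P1 mulf_neq0 ?invr_eq0 ?pnatr_eq0.
have [_ S2] := coef_graded_sum (fun j => dual_coef c N k j / (j.+1)`!%:R) k size_dual_basis.
rewrite P1_companion (leq_trans (size_polyD _ _))// geq_max; apply/andP; split.
  by rewrite (leq_trans (size_scale_leq _ _))// size_P2.
rewrite (leq_trans (size_scale_leq _ _))// (leq_trans (size_polyMleq _ _))//.
by rewrite size_XsubC /=.
Qed.

(** On the quadratic lattice theta n the basis polynomials factor, by
    dual_basis_theta; going from n to n + 1 replaces one factor in each
    of the two products. *)
Lemma dual_basis_thetaS n j :
  (n%:R + 1) * (n%:R + al + c - N - j%:R) * (r j).[th n.+1] =
  (n%:R + al + c - N) * (n%:R + 1 + j%:R) * (r j).[th n].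
Proof.
elim: j => [|j IH]; first by rewrite dual_basis0 !hornerC; ring.
rewrite dual_basisS !hornerN !hornerM !hornerD !hornerX !hornerC.
move: (r j).[th n.+1] (r j).[th n] IH => x y IH.
transitivity (- ((n%:R + al + c - N - j%:R - 1) * (n%:R + 2 + j%:R)) *
   ((n%:R + 1) * (n%:R + al + c - N - j%:R) * x)).
  by rewrite /theta -!natr1; ring.
rewrite IH /theta -!natr1; ring.
Qed.

(** The sums are compared term by term, each by dual_basis_thetaS. *)
Lemma P1_recur n : (P1 al c N k).[th n.+1] - (P1 al c N k).[th n] =
  sigma al c N n.+2 * gamma al c N k n.+2 + sigma al c N n.+1 * gamma al c N k n.+1.
Proof.
rewrite !gamma_theta P1_companion !hornerD !hornerZ !hornerM !hornerXsubC /P2.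
rewrite !dual_hahn2_horner /dual_companion !horner_sum !mulr_sumr.
rewrite -!big_split -sumrB /=; apply: eq_bigr => j _.
have hz a x : (a *: r j).[x] = a * (r j).[x] by exact: hornerZ.
rewrite !hz.
have f0 := @fact_neq0 R j.
have j1 : j%:R + 1 != 0 :> R by rewrite natr1.
rewrite factS natrM.
apply/eqP; rewrite -subr_eq0; apply/eqP.
have E := dual_basis_thetaS n j.
transitivity (dual_coef c N k j / ((j%:R + 1) * j`!%:R) * 2 *
  ((n%:R + 1) * (n%:R + al + c - N - j%:R) * (r j).[th n.+1] -
  (n%:R + al + c - N) * (n%:R + 1 + j%:R) * (r j).[th n])); last first.
  by rewrite E subrr mulr0.
move: (r j).[th n.+1] (r j).[th n] => x y.
rewrite /theta /sigma -!natr1. field.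
by rewrite f0 j1.
Qed.

End DualPolynomials.

(** * Polynomials in an operator and the eigenvalues of the Krall operator *)

Section OperatorPolynomials.
Context {R : realType}.
Implicit Types (P p : {poly R}).
Variable T : {linear {poly R} -> {poly R}}.

Lemma iter_linear j (a : R) p r : iter j T (a *: p + r) = a *: iter j T p + iter j T r.
Proof. by elim: j => [//|j IH]; rewrite !iterS IH linearP. Qed.

Lemma op_poly_linear P : linear (op_poly P T).
Proof.
move=> a p r; rewrite /op_poly scaler_sumr -big_split; apply: eq_bigr => j _ /=.
by rewrite iter_linear scalerDr !scalerA mulrC.
Qed.

HB.instance Definition _ P :=
  GRing.isLinear.Build R {poly R} {poly R} *:%R (op_poly P T) (op_poly_linear P).

Lemma op_poly_eigen P (t : R) p : T p = t *: p -> op_poly P T p = P.[t] *: p.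
Proof.
move=> Tp; have it j : iter j T p = t ^+ j *: p.
  by elim: j => [|j IH]; rewrite ?scale1r// iterS IH linearZ /= Tp scalerA exprSr.
rewrite /op_poly horner_coef scaler_suml; apply: eq_bigr => j _.
by rewrite it scalerA.
Qed.

End OperatorPolynomials.

Section KrallEigen.
Context {R : realType}.
Variables (al c N : R) (k : nat).
Hypothesis hu0 : forall m : nat, al + c - N + m%:R != 0.
Hypothesis hgamma : forall n, gamma al c N k n != 0.
Let hu m : al + c - N + m.+1%:R != 0 := hu0 m.+1.

Local Notation h := (hahn al c N).

(** For n > 0 the values of P2 at theta_n and theta_(n-1) turn q_n into a multiple
    of h_n + eps_n h_(n-1); after hahn_ladder the coefficients of h_n and h_(n-1)
    are compared, the former by P1_recur. *)
Lemma krall_eigen n : krall_op al c N k (q al c N k n)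
  = lambda al c N k n *: q al c N k n.
Proof.
rewrite /krall_op; set D := hahn_op al c N.
have De m P : op_poly P D (h m) = P.[theta al c N m] *: h m.
  exact: op_poly_eigen (hahn_eigen hu m).
case: n => [|n].
  rewrite /= -(hahn0 al c N) !De hahn0.
  have -> : nabla ((P2 al c N k).[theta al c N 0] *: 1 : {poly R}) = 0.
    by rewrite linearZ /= /nabla rmorph1 subrr scaler0.
  rewrite mulr0 addr0 !scalerA -scalerBl; congr (_ *: _).
  by rewrite /sigma; field.
have -> : lambda al c N k n.+1 = (sigma al c N n.+1 * gamma al c N k n.+1
   + (P1 al c N k).[theta al c N n]) / 2 by [].
have -> : q al c N k n.+1 = h n.+1 + beta al c N k n.+1 *: h n by [].
set b := beta _ _ _ _ _.
have Dl P : op_poly P D (h n.+1 + b *: h n) =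
    P.[theta al c N n.+1] *: h n.+1 + (b * P.[theta al c N n]) *: h n.
  have E : op_poly P D (b *: h n + h n.+1) =
      b *: op_poly P D (h n) + op_poly P D (h n.+1) by exact: op_poly_linear.
  by rewrite addrC E !De scalerA addrC.
rewrite !Dl.
have G2 : (P2 al c N k).[theta al c N n.+1] = gamma al c N k n.+2 by rewrite gamma_theta.
have G1 : (P2 al c N k).[theta al c N n] = gamma al c N k n.+1 by rewrite gamma_theta.
rewrite G2 G1.
have bE : b * gamma al c N k n.+1 = gamma al c N k n.+2 * ladder_coef al c N n.+1.
  by rewrite /b /beta -/(ladder_coef al c N n.+1) -mulrA divfK ?hgamma// mulrC.
have -> : gamma al c N k n.+2 *: h n.+1 + (b * gamma al c N k n.+1) *: h n =
    gamma al c N k n.+2 *: (h n.+1 + ladder_coef al c N n.+1 *: h n).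
  by rewrite bE scalerDr scalerA.
rewrite [nabla _]linearZ /= -scalerAr hahn_ladder//.
have P1r := P1_recur al c N k n.
set x1 := (P1 al c N k).[theta al c N n.+1] in P1r *.
set x0 := (P1 al c N k).[theta al c N n] in P1r *.
have {P1r} x1E : x1 = x0 +
   (sigma al c N n.+2 * gamma al c N k n.+2 + sigma al c N n.+1 * gamma al c N k n.+1).
  by rewrite -P1r addrC subrK.
set g2 := gamma _ _ _ _ n.+2 in bE x1E *; set g1 := gamma _ _ _ _ n.+1 in bE x1E *.
set d := ladder_coef _ _ _ _ in bE *.
move: (h n.+1) (h n) => H1 H0.
transitivity ((2^-1 * x1 - (al + c - N) * 2^-1 * g2 - g2 * n.+1%:R) *: H1
  + (2^-1 * b * x0 - (al + c - N) * 2^-1 * g2 * d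
     + g2 * (n%:R + al + c - N) * d) *: H0).
  move: (2^-1 : R) => i2; rewrite -!mul_polyC; ring.
rewrite scalerDr scalerA; congr (_ *: _ + _ *: _).
  by rewrite x1E /sigma -!natr1; field.
transitivity (2^-1 * b * x0 + (2 * n%:R + al + c - N) / 2 * (g2 * d)); first by field.
by rewrite -bE /sigma -natr1; field.
Qed.

End KrallEigen.

(** * Order and genre *)

Section Genre.
Context {R : realType}.
Implicit Types (f g : int -> {poly R}) (D : {poly R} -> {poly R}) (p : {poly R}).
Implicit Types (m M : nat) (l : int).

(** A difference operator whose coefficients f vanish outside [-m, m].  Allowing
    every window [-M, M] that contains the support makes sums and compositions of
    operators with different supports easy to form. *)
Definition windowed m f D : Prop :=
  (forall l, (m < `|l|)%N -> f l = 0) /\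
  forall M p, (m <= M)%N ->
    D p = \sum_(i < (2 * M).+1) f (i%:Z - M%:Z) * shift_op (i%:Z - M%:Z) p.

Lemma sum_window_shift (G : int -> {poly R}) M :
  G (- M%:Z) = 0 -> G (M.+1%:Z) = 0 ->
  \sum_(i < (2 * M).+1) G (i%:Z - M%:Z + 1) = \sum_(i < (2 * M).+1) G (i%:Z - M%:Z).
Proof.
move=> Gl Gr.
have E1 : \sum_(i < (2 * M).+2) G (i%:Z - M%:Z) = \sum_(i < (2 * M).+1) G (i%:Z - M%:Z).
  rewrite big_ord_recr /= (_ : (2 * M).+1%:Z - M%:Z = M.+1%:Z) ?Gr ?addr0//.
  by rewrite mul2n -addnn; lia.
rewrite -E1 [RHS]big_ord_recl /= sub0r Gl add0r.
by apply: eq_bigr => i _; rewrite /bump /= add1n; congr G; lia.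
Qed.

Lemma windowed_id : windowed 0 (fun l => if l == 0 then 1 else 0) id.
Proof.
split=> [l|M p _]; first by case: eqP => [->|].
have MM : (M < (2 * M).+1)%N by rewrite ltnS mul2n -addnn leq_addr.
rewrite (bigD1 (Ordinal MM)) //= subrr eqxx shift_op0 mul1r big1 ?addr0// => i iM.
case: eqP => [E|_]; last by rewrite mul0r.
move/eqP: iM; case; apply: val_inj => /=; lia.
Qed.

Lemma windowed_widen m m' f D : (m <= m')%N -> windowed m f D -> windowed m' f D.
Proof.
move=> mm' [f0 fD]; split=> [l lm|M p m'M]; first by apply: f0; exact: leq_ltn_trans lm.
exact/fD/(leq_trans mm').
Qed.

Lemma windowed_add m f g D E : windowed m f D -> windowed m g E ->
  windowed m (fun l => f l + g l) (fun p => D p + E p).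
Proof.
move=> [f0 fD] [g0 gE]; split=> [l lm|M p mM]; first by rewrite f0// g0// addr0.
by rewrite (fD M)// (gE M)// -big_split; apply: eq_bigr => i _; rewrite mulrDl.
Qed.

Lemma windowed_mul m f D (a : {poly R}) : windowed m f D ->
  windowed m (fun l => a * f l) (fun p => a * D p).
Proof.
move=> [f0 fD]; split=> [l lm|M p mM]; first by rewrite f0// mulr0.
by rewrite (fD M)// mulr_sumr; apply: eq_bigr => i _; rewrite mulrA.
Qed.

Lemma windowed_ext m f g D E : f =1 g -> D =1 E -> windowed m f D -> windowed m g E.
Proof.
move=> fg DE [f0 fD]; split=> [l lm|M p mM]; first by rewrite -fg f0.
by rewrite -DE (fD M)//; apply: eq_bigr => i _; rewrite fg.
Qed.

Lemma windowed_shiftr m f D : windowed m f D ->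
  windowed m.+1 (fun l => shift_op 1 (f (l - 1))) (fun p => shift_op 1 (D p)).
Proof.
move=> [f0 fD]; split=> [l lm|M p mM]; first by rewrite f0 ?rmorph0//; lia.
pose G l := shift_op 1 (f (l - 1)) * shift_op l p.
rewrite (fD M p (ltnW mM)) rmorph_sum -(sum_window_shift (G := G)) /G.
- apply: eq_bigr => i _; rewrite rmorphM /= shift_opD; congr (shift_op 1 (f _) * shift_op _ p); lia.
- by rewrite f0 ?rmorph0 ?mul0r//; lia.
- by rewrite f0 ?rmorph0 ?mul0r//; lia.
Qed.

Lemma windowed_shiftl m f D : windowed m f D ->
  windowed m.+1 (fun l => shift_op (-1) (f (l + 1))) (fun p => shift_op (-1) (D p)).
Proof.
move=> [f0 fD]; split=> [l lm|M p mM]; first by rewrite f0 ?rmorph0//; lia.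
pose G l := shift_op (-1) (f l) * shift_op (l - 1) p.
rewrite (fD M p (ltnW mM)) rmorph_sum.
transitivity (\sum_(i < (2 * M).+1) G (i%:Z - M%:Z)).
  by apply: eq_bigr => i _; rewrite rmorphM /= shift_opD /G; congr (_ * shift_op _ p); lia.
rewrite -sum_window_shift /G.
- by apply: eq_bigr => i _; congr (_ * shift_op _ p); lia.
- by rewrite f0 ?rmorph0 ?mul0r//; lia.
- by rewrite f0 ?rmorph0 ?mul0r//; lia.
Qed.

Lemma windowed_sum n (m : nat) (F : nat -> int -> {poly R}) (D : nat -> {poly R} -> {poly R}) :
  (forall j, (j < n)%N -> windowed m (F j) (D j)) ->
  windowed m (fun l => \sum_(j < n) F j l) (fun p => \sum_(j < n) D j p).
Proof.
move=> FD; split=> [l lm|M p mM].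
  by rewrite big1// => j _; have [-> //] := FD j (ltn_ord j).
under [RHS]eq_bigr do rewrite mulr_suml.
rewrite exchange_big /=; apply: eq_bigr => j _.
by have [_ H] := FD j (ltn_ord j); exact: H.
Qed.

Lemma windowed_order_genre m f D : windowed m f D ->
  f m%:Z != 0 -> f (- m%:Z) != 0 ->
  diff_op_order_genre D (2 * m) (- m%:Z) m%:Z.
Proof.
move=> [f0 fD] fm fNm; split; first by rewrite opprK; lia.
exists f; split=> // p; rewrite (fD m p (leqnn m)).
by apply: eq_bigr => i _; rewrite addrC.
Qed.

Section HahnPowers.
Variables al c N : R.

Local Notation lft := ('X * ('X - al%:P) : {poly R}).
Local Notation rgt := (hahn_right c N).
Local Notation mid := (- 2 *: 'X^2 + (al - c + N - 1) *: 'X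
  + (al + N * (c - 1) - 1)%:P : {poly R}).

(** The recursion is composition with one more Hahn operator on the left: the outer
    shifts act on the coefficients of the inner operator as well. *)
Fixpoint power_coef j : int -> {poly R} :=
  if j is i.+1 then fun l =>
    lft * shift_op (-1) (power_coef i (l + 1)) + mid * power_coef i l
    + rgt * shift_op 1 (power_coef i (l - 1))
  else fun l => if l == 0 then 1 else 0.

Lemma windowed_power j : windowed j (power_coef j) (iter j (hahn_op al c N)).
Proof.
elim: j => [|j IH]; first exact: windowed_id.
rewrite /=; apply: windowed_add.
  apply: windowed_add; first exact/windowed_mul/windowed_shiftl.
  by apply: windowed_mul; apply: windowed_widen IH.
exact/windowed_mul/windowed_shiftr.
Qed.

Lemma power_coef_out j l : (j < `|l|)%N -> power_coef j l = 0.
Proof. exact: (windowed_power j).1. Qed.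

Lemma power_coef_right j : power_coef j.+1 j.+1%:Z = rgt * shift_op 1 (power_coef j j%:Z).
Proof.
have e1 : power_coef j (j.+1%:Z + 1) = 0 by apply: power_coef_out; lia.
have e2 : power_coef j j.+1%:Z = 0 by apply: power_coef_out; lia.
have e3 : j.+1%:Z - 1 = j%:Z by lia.
by rewrite [LHS]/= e1 e2 e3 rmorph0 !mulr0 !add0r.
Qed.

Lemma power_coef_left j :
  power_coef j.+1 (- j.+1%:Z) = lft * shift_op (-1) (power_coef j (- j%:Z)).
Proof.
have e1 : power_coef j (- j.+1%:Z - 1) = 0 by apply: power_coef_out; lia.
have e2 : power_coef j (- j.+1%:Z) = 0 by apply: power_coef_out; lia.
have e3 : - j.+1%:Z + 1 = - j%:Z by lia.
by rewrite [LHS]/= e1 e2 e3 rmorph0 !mulr0 !addr0.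
Qed.

Lemma shift_op_eq0 l p : (shift_op l p == 0) = (p == 0).
Proof.
apply/eqP/eqP => [E|->]; last exact: rmorph0.
by rewrite -[p]shift_op0 -(addNr l) -shift_opD E rmorph0.
Qed.

Lemma power_coef_right_neq0 j : power_coef j j%:Z != 0.
Proof.
elim: j => [|j IH]; first by rewrite /= oner_eq0.
rewrite power_coef_right mulf_neq0 ?shift_op_eq0// /hahn_right mulf_neq0 ?polyXsubC_eq0//.
by rewrite -[c]opprK polyCN polyXsubC_eq0.
Qed.

Lemma power_coef_left_neq0 j : power_coef j (- j%:Z) != 0.
Proof.
elim: j => [|j IH]; first by rewrite /= oner_eq0.
by rewrite power_coef_left !mulf_neq0 ?shift_op_eq0 ?polyX_eq0 ?polyXsubC_eq0.
Qed.

Definition op_poly_coef (P : {poly R}) l : {poly R} :=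
  \sum_(j < size P) (P`_j)%:P * power_coef j l.

Lemma windowed_op_poly (P : {poly R}) : P != 0 ->
  windowed (size P).-1 (op_poly_coef P) (op_poly P (hahn_op al c N)).
Proof.
move=> P0; have sP : (0 < size P)%N by rewrite size_poly_gt0.
apply: (windowed_ext (f := op_poly_coef P)
  (D := fun p => \sum_(j < size P) (P`_j)%:P * iter j (hahn_op al c N) p)) => //.
  by move=> p; rewrite /op_poly; apply: eq_bigr => j _; rewrite mul_polyC.
apply: (windowed_sum (F := fun j l => (P`_j)%:P * power_coef j l)
  (D := fun j p => (P`_j)%:P * iter j (hahn_op al c N) p)) => j jP.
apply: windowed_mul; apply: windowed_widen (windowed_power j).
by rewrite -ltnS prednK.
Qed.

Lemma op_poly_coef_edge (P : {poly R}) m l : size P = m.+1 -> `|l|%N = m ->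
  op_poly_coef P l = (P`_m)%:P * power_coef m l.
Proof.
move=> sP lm; rewrite /op_poly_coef sP big_ord_recr /= big1 ?add0r// => j _.
by rewrite power_coef_out ?mulr0// lm.
Qed.

End HahnPowers.

(** At k + 1 only P1(hahn_op) contributes.  At - k - 1 both parts do; for b the
    left coefficient of the k-th power, shifted by - 1, their sum is
    (x - al) b (x / (k + 1) + 1), which is not zero. *)
Lemma krall_order_genre (al c N : R) k :
  diff_op_order_genre (krall_op al c N k) (2 * k + 2) (- (k.+1)%:Z) (k.+1)%:Z.
Proof.
pose f1 := op_poly_coef al c N (P1 al c N k).
pose f2 := op_poly_coef al c N (P2 al c N k).
have s1 := size_P1 al c N k; have s2 := size_P2 al c N k.
have W1 : windowed k.+1 f1 (op_poly (P1 al c N k) (hahn_op al c N)).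
  have P10 : P1 al c N k != 0 by rewrite -size_poly_eq0 s1.
  by have := windowed_op_poly al c N P10; rewrite s1.
have W2 : windowed k f2 (op_poly (P2 al c N k) (hahn_op al c N)).
  have P20 : P2 al c N k != 0 by rewrite -size_poly_eq0 s2.
  by have := windowed_op_poly al c N P20; rewrite s2.
have W2' : windowed k.+1 f2 (op_poly (P2 al c N k) (hahn_op al c N)).
  exact: windowed_widen W2.
pose f l := (2^-1)%:P * f1 l + ((- ((al + c - N) / 2))%:P * f2 l
  + (- ('X - al%:P) * f2 l + ('X - al%:P) * shift_op (-1) (f2 (l + 1)))).
have W : windowed k.+1 f (krall_op al c N k).
  apply: (windowed_ext (fun=> erefl) _
    (windowed_add (windowed_mul (2^-1)%:P W1)
      (windowed_add (windowed_mul (- ((al + c - N) / 2))%:P W2')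
        (windowed_add (windowed_mul (- ('X - al%:P)) W2')
          (windowed_mul ('X - al%:P) (windowed_shiftl W2)))))) => p.
  rewrite /krall_op /nabla -!mul_polyC.
  move: (op_poly _ _ p) (op_poly _ _ p) => A B.
  move: (2^-1)%:P ((_ / 2)) => x y; ring.
have -> : (2 * k + 2 = 2 * k.+1)%N by rewrite mulnS addnC.
apply: (windowed_order_genre W); rewrite /f.
  rewrite !W2.1; try lia.
  rewrite rmorph0 !mulr0 !addr0 mulf_neq0 ?polyC_eq0 ?invr_eq0 ?pnatr_eq0//.
  rewrite /f1 (op_poly_coef_edge _ _ _ s1)// mulf_neq0 ?power_coef_right_neq0//.
  by rewrite polyC_eq0 coef_P1 mulf_neq0 ?invr_eq0 ?pnatr_eq0.
rewrite [f2 (- _)]W2.1; last lia.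
rewrite (_ : - k.+1%:Z + 1 = - k%:Z); last lia.
rewrite !mulr0 !add0r /f1 /f2 (op_poly_coef_edge _ _ _ s1) ?abszN//.
rewrite (op_poly_coef_edge _ _ _ s2) ?abszN// coef_P1 coef_P2 power_coef_left.
rewrite mul1r; set b := shift_op _ _.
have b0 : b != 0 by rewrite /b shift_op_eq0 power_coef_left_neq0.
rewrite (_ : _ + _ = (k.+1%:R^-1)%:P * ('X - al%:P) * b * ('X - (- k.+1%:R)%:P)); last first.
  have k1 : k.+1%:R != 0 :> R by rewrite pnatr_eq0.
  have e2 : (2^-1 : R)%:P * 2%:P = 1 by rewrite -polyCM mulVf ?pnatr_eq0.
  have ek : (k.+1%:R^-1 : R)%:P * (k.+1%:R)%:P = 1 by rewrite -polyCM mulVf.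
  rewrite polyCM; move: (k.+1%:R^-1 : R)%:P (2^-1 : R)%:P e2 ek => x y e2 ek.
  transitivity ((y * 2%:P) * (x * ('X * ('X - al%:P) * b))
    + (x * (k.+1%:R)%:P) * (('X - al%:P) * b)).
    by rewrite ek; ring.
  rewrite e2; ring.
by rewrite !mulf_neq0 ?polyXsubC_eq0 ?polyC_eq0 ?invr_eq0 ?pnatr_eq0.
Qed.

End Genre.

(** * The functional of the theorem *)

Section Assembly.
Context {R : realType}.
Implicit Types (p : {poly R}) (al c N : R) (k n : nat).

Lemma shift_functional_pearson al c N s (L : {scalar {poly R}}) :
  hahn_pearson (al + s) (c - s) (N + s) L ->
  shifted_pearson al c N s (shift_functional L s).
Proof.
move=> LP p; rewrite /shift_functional !comp_polyM shift_comp.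
have -> : ('X + s%:P) \Po ('X - s%:P) = 'X by rewrite comp_polyD comp_polyX comp_polyC subrK.
have -> : ('X - al%:P) \Po ('X - s%:P) = 'X - (al + s)%:P.
  by rewrite comp_polyB comp_polyX comp_polyC; ring.
rewrite LP; congr (L (_ * _)).
rewrite /hahn_right comp_polyB comp_polyD comp_polyX !comp_polyC; ring.
Qed.

Lemma prod_poch k : \prod_(1 <= i < k.+1) ('X + i%:R%:P) = poch ('X + 1) k :> {poly R}.
Proof.
rewrite big_add1 /= big_mkord; apply: eq_bigr => i _.
by rewrite -natr1 rmorphD /= polyC1 rmorph_nat; ring.
Qed.

Lemma rho_tilde_geronimus al c N k (L : {scalar {poly R}}) :
  hahn_functional (al + k%:R + 1) (c - k%:R - 1) (N + k%:R + 1) = L ->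
  rho_tilde al c N k = geronimus k (shift_functional L (k%:R + 1)).
Proof. by move=> E; rewrite /rho_tilde E prod_poch. Qed.

Section Measure.
Variables (al c : R) (k M : nat).
Hypothesis M0 : (0 < M)%N.
Let N : R := M%:R.
Hypothesis haN : forall m : nat, al - N + 1 + m%:R != 0.
Hypothesis hc : forall m : nat, c - k%:R - 1 + m%:R != 0.

(** After the shift the support is {-k-1, ..., M-1}; the factor (x+1)...(x+k)
    kills the points -k, ..., -1 and isolates a mass at -k-1. *)
Lemma rho_tilde_measure : exists L : {scalar {poly R}},
  [/\ hahn_pearson (al + k%:R + 1) (c - k%:R - 1) (N + k%:R + 1) L,
     hahn_functional (al + k%:R + 1) (c - k%:R - 1) (N + k%:R + 1) = L &
  forall p : {poly R}, rho_tilde al c N k p =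
          (-1) ^+ k * k`!%:R * Gamma (al + k%:R + 1) * Gamma (c - k%:R - 1)
            * p.[- k%:R - 1]
          + Gamma (N + k%:R + 1) * \sum_(x < M)
              Gamma (al - x%:R) * Gamma (x%:R + c)
                / ((x%:R + k%:R + 1) * Gamma (N - x%:R) * x`!%:R) * p.[x%:R]].
Proof.
pose K := (k.+1 + M)%N.
have NE : N + k%:R + 1 = K%:R by rewrite /K natrD -natr1 /N; ring.
have [||//|L LP [LE LF]] := @hahn_functional_measure R K (al + k%:R + 1) (c - k%:R - 1).
- by move=> m; have := haN m; congr (_ != 0); rewrite -NE; ring.
- exact: hc.
- rewrite /K -NE in LP LE LF *; exists L; split=> // p.
rewrite (rho_tilde_geronimus LE) /geronimus /polymul_functional /shift_functional [LHS]LF.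
have gN : Gamma (N + k%:R + 1) != 0.
  by rewrite gt_eqF// Gamma_gt0// NE ltr0n.
have term x : ((poch ('X + 1) k * p) \Po ('X - (k%:R + 1)%:P)).[x] =
    poch (x - k%:R) k * p.[x - (k%:R + 1)].
  rewrite horner_comp hornerXsubC hornerM horner_poch hornerD hornerX hornerC.
  by congr (poch _ _ * _); ring.
under eq_bigr do rewrite term.
rewrite big_split_ord big_ord_recl /= big1 ?addr0 => [|i _]; last first.
  rewrite /bump /= add1n (_ : i.+1%:R - k%:R = - (k - i.+1)%:R).
    by rewrite poch_opp0 ?mul0r ?mulr0// ltn_subrL /=; case: i => [[|?] /=]; lia.
  by rewrite natrB; [ring | exact: ltn_ord].
rewrite mulrDr; congr (_ + _).
  rewrite sub0r poch_opp /hahn_weight subr0 add0r !subr0 fact0 mulr1.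
  rewrite (_ : 0 - (k%:R + 1) = - k%:R - 1); last by ring.
  by field.
congr (_ * _); apply: eq_bigr => i _.
rewrite /hahn_weight.
have kiE : (k.+1 + i)%:R = k%:R + i%:R + 1 :> R by rewrite natrD -natr1; ring.
rewrite !kiE.
rewrite (_ : al + k%:R + 1 - (k%:R + i%:R + 1) = al - i%:R); last by ring.
rewrite (_ : k%:R + i%:R + 1 + (c - k%:R - 1) = i%:R + c); last by ring.
rewrite (_ : N + k%:R + 1 - (k%:R + i%:R + 1) = N - i%:R); last by ring.
rewrite (_ : k%:R + i%:R + 1 - k%:R = i%:R + 1); last by ring.
rewrite (_ : k%:R + i%:R + 1 - (k%:R + 1) = i%:R); last by ring.
rewrite addSn addnC factS natrM poch_fact -natr1 natrD.
have gi : Gamma (N - i%:R) != 0.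
  by rewrite gt_eqF// Gamma_gt0// subr_gt0 ltr_nat.
have pk : poch (i%:R + 1) k != 0 :> R.
  apply: poch_neq0 => l _.
  rewrite (_ : i%:R + 1 + l%:R = (i + l).+1%:R) ?pnatr_eq0//.
  by rewrite -natr1 natrD; ring.
have ik : i%:R + k%:R + 1 != 0 :> R by rewrite -natrD natr1 pnatr_eq0.
field.
by rewrite pk fact_neq0 gi ik.
Qed.

End Measure.

End Assembly.

(* The hypothesis al + c - N != 0 says that the denominator of beta_1 does not
   vanish.  In the case where N is not a positive integer, the functional
   rho_{al+k+1, c-k-1, N+k+1} has to be defined by orthogonality, which is the
   hypothesis hahn_generic. *)
Theorem theorem7p8 (R : realType) (k : nat) (al c N : R)
    (hk : (1 <= k)%N)
    (h1 : ~~ nonposint (al + c - N + 1))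
    (h2 : ~~ nonposint (al - N + 1))
    (h3 : ~~ nonposint (al + c))
    (h4 : ~~ nonposint (c - k%:R - 1))
    (hbeta : al + c - N != 0)
    (hgamma : forall n : nat,
      (dual_hahn2 al c N k).[n%:R * (n%:R - 2 - N + al + c)] != 0) :
  [/\ size (P2 al c N k) = k.+1 /\ size (P1 al c N k) = k.+2,
      ~~ posint N ->
        hahn_generic (al + k%:R + 1) (c - k%:R - 1) (N + k%:R + 1) ->
        orthogonal_polys (rho_tilde al c N k) xpredT (q al c N k),
      forall M : nat, (0 < M)%N -> N = M%:R ->
        (forall p : {poly R}, rho_tilde al c N k p =
          (-1) ^+ k * k`!%:R * Gamma (al + k%:R + 1) * Gamma (c - k%:R - 1)
            * p.[- k%:R - 1]
          + Gamma (N + k%:R + 1) * \sum_(x < M)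
              Gamma (al - x%:R) * Gamma (x%:R + c)
                / ((x%:R + k%:R + 1) * Gamma (N - x%:R) * x`!%:R) * p.[x%:R]) /\
        orthogonal_polys (rho_tilde al c N k) (fun n => (n <= M)%N) (q al c N k) &
      diff_op_order_genre (krall_op al c N k) (2 * k + 2)
        (- (k.+1)%:Z) (k.+1)%:Z /\
      forall n : nat, krall_op al c N k (q al c N k n)
        = lambda al c N k n *: q al c N k n].
Proof.
have hu0 (m : nat) : al + c - N + m%:R != 0.
  case: m => [|m]; first by rewrite addr0.
  by have := nonposint_addn_neq0 h1 m; congr (_ != 0); rewrite -natr1; ring.
have hu (m : nat) : al + c - N + m.+1%:R != 0 by exact: hu0.
have haN (m : nat) : al - N + 1 + m%:R != 0.
  by have := nonposint_addn_neq0 h2 m; congr (_ != 0); ring.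
have hac := nonposint_addn_neq0 h3; have hc' := nonposint_addn_neq0 h4.
have hc (m : nat) : c + m%:R != 0.
  by have := hc' (m + k.+1)%N; congr (_ != 0); rewrite natrD -natr1; ring.
have hcj j : (j <= k)%N -> c - j.+1%:R != 0.
  move=> jk; have := hc' (k - j)%N; congr (_ != 0).
  by rewrite natrB// -natr1; ring.
have hg : forall n, gamma al c N k n != 0 by exact: hgamma.
have shiftE (L : {scalar {poly R}}) :
    hahn_pearson (al + k%:R + 1) (c - k%:R - 1) (N + k%:R + 1) L ->
    shifted_pearson al c N (k%:R + 1) (shift_functional L (k%:R + 1)).
  move=> LP; apply: shift_functional_pearson; move: LP.
  by rewrite !addrA opprD addrA.
split.
- by rewrite size_P2 size_P1.
- move=> hN hgen; have [L LP [LE L1]] := hahn_functional_generic hgen.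
  have nuP := shiftE L LP.
  rewrite (rho_tilde_geronimus LE).
  have hNj j : (j <= k)%N -> N + j%:R != 0.
    move=> jk; apply/eqP => Nj; move: hgen => /and5P[+ _ _ _ _]; apply/negP/negPn.
    have -> : N + k%:R + 1 = (k - j).+1%:R.
      by rewrite -natr1 natrB//; move: Nj => /(canRL (addrK _)) ->; ring.
    by rewrite /posint natr_nat ltr0n.
  have nu1 : shift_functional L (k%:R + 1) 1 != 0.
    by rewrite /shift_functional -polyC1 comp_polyC polyC1.
  (* The mass of nu is prescribed, and non-vanishing passes down the chain. *)
  have mass j : (j <= k.+1)%N -> chain k (shift_functional L (k%:R + 1)) j 1 != 0.
    move=> jk; rewrite -(subKn jk); elim: (k.+1 - j)%N (leq_subr j k.+1) => [|i IH] ik.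
      by rewrite subn0 chain_top; exact: nu1.
    have ji : (k.+1 - i = (k.+1 - i.+1).+1)%N by rewrite -subSn.
    have := IH (ltnW ik); rewrite ji; set m := (k.+1 - i.+1)%N.
    have mk : (m <= k)%N by rewrite /m subSS leq_subr.
    apply: contra_neq => m0; have := chain_mass_step nuP mk.
    rewrite m0 mulr0 => /esym/eqP; rewrite !mulf_eq0 (negbTE (hcj _ mk)).
    by rewrite (negbTE (hNj _ mk)) => /eqP.
  apply: geronimus_orthogonal => //; first exact: mass.
  move=> n _; apply: (hahn_norm_neq0 (chain0_hahn_pearson nuP)) => //; last exact: mass.
  move=> i /andP[i0 _]; apply: contra hN => /eqP ->.
  by rewrite /posint natr_nat ltr0n.
- move=> M M0 NM.
  have [||L [LP LE LF]] := @rho_tilde_measure R al c k M M0; rewrite -?NM//.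
  rewrite -NM in LP LE LF.
  split=> //.
  have nuP := shiftE L LP.
  have rhoE := rho_tilde_geronimus LE.
  set nu := shift_functional L _ in nuP rhoE.
  have LP0 := chain0_hahn_pearson nuP.
  have chainE p : chain k nu 0 p = Gamma (N + k%:R + 1) * \sum_(x < M)
              Gamma (al - x%:R) * Gamma (x%:R + c)
                / (Gamma (N - x%:R) * x`!%:R) * p.[x%:R].
    rewrite chain0_geronimus -rhoE LF.
    rewrite !hornerM !hornerD !hornerX !hornerC.
    rewrite (_ : - k%:R - 1 + (k%:R + 1) = 0); last by ring.
    rewrite mul0r mulr0 add0r; congr (_ * _); apply: eq_bigr => i _.
    have ik : i%:R + k%:R + 1 != 0 :> R by rewrite -natrD natr1 pnatr_eq0.
    have gi : Gamma (N - i%:R) != 0.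
      by rewrite gt_eqF// Gamma_gt0// subr_gt0 NM ltr_nat.
    rewrite !hornerM !hornerD !hornerX !hornerC.
    by field; rewrite fact_neq0 gi ik.
  (* (x - M + 1)_(M - 1) vanishes at 1, ..., M - 1, so one term is left. *)
  have top : chain k nu 0 (poch ('X - (N - 1)%:P) M.-1) != 0.
    have hornerE' x : (poch ('X - (N - 1)%:P) M.-1).[x%:R] = poch (x%:R - (N - 1)) M.-1.
      by rewrite horner_poch hornerXsubC.
    have M1 : M.-1%:R = N - 1 by rewrite NM -[in RHS](prednK M0) -natr1 addrK.
    rewrite chainE (bigD1 (Ordinal M0)) //= big1 ?addr0 => [|i i0]; last first.
      rewrite hornerE' (_ : i%:R - (N - 1) = - (M.-1 - i)%:R).
        rewrite poch_opp0 ?mulr0// ltn_subrL.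
        have i1 : (0 < i)%N.
          by rewrite lt0n; apply: contra i0 => /eqP i0; apply/eqP/val_inj.
        by rewrite i1 (leq_trans i1)// -ltnS prednK ?ltn_ord.
      by rewrite natrB; [rewrite M1; ring | by rewrite -ltnS prednK ?ltn_ord].
    rewrite hornerE' !subr0 add0r sub0r -M1 poch_opp.
    have gN : Gamma (N + k%:R + 1) != 0.
      by rewrite gt_eqF// Gamma_gt0// NM -natrD natr1 ltr0n.
    have g1 : Gamma N != 0 by rewrite gt_eqF// Gamma_gt0// NM ltr0n.
    have g2 : Gamma c != 0 by exact: Gamma_neq0.
    have g3 : Gamma al != 0.
      apply: Gamma_neq0 => m; have := haN (M.-1 + m)%N; congr (_ != 0).
      by rewrite natrD M1; ring.
    move: (Gamma _) (Gamma _) (Gamma _) (Gamma _) gN g1 g2 g3 => A B C D A0 B0 C0 D0.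
    by rewrite !mulf_neq0 ?invr_eq0 ?mulf_neq0 ?fact_neq0 ?signr_eq0.
  have low j : (j <= M.-1)%N -> chain k nu 0 (poch ('X - (N - 1)%:P) j) != 0.
    move=> jM; rewrite -(subKn jM); elim: (M.-1 - j)%N (leq_subr j M.-1) => [|i IH] ik.
      by rewrite subn0.
    have ji : (M.-1 - i = (M.-1 - i.+1).+1)%N by rewrite -subSn.
    have := IH (ltnW ik); rewrite ji; set m := (M.-1 - i.+1)%N.
    apply: contra_neq => m0.
    have E : (al + c - N + m.+1%:R) * chain k nu 0 (poch ('X - (N - 1)%:P) m.+1) =
        (N - 1 - m%:R) * (N - 1 - m%:R - al) * chain k nu 0 (poch ('X - (N - 1)%:P) m).
      exact: mass_lowering.
    by move/eqP: E; rewrite m0 mulr0 mulf_eq0 (negbTE (hu m)) => /eqP.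
  have mass0 : chain k nu 0 1 != 0 by have := low 0%N isT; rewrite poch0.
  (* In contrast to the generic case the chain is climbed, from 0 to 1. *)
  have mass1 : chain k nu 1 1 != 0.
    apply: contra_neq mass0 => m0; have := chain_mass_step nuP (leq0n k).
    rewrite m0 mulr0 => /eqP; rewrite mulf_eq0 subr0 (negbTE hbeta) => /eqP //.
  rewrite rhoE; apply: geronimus_orthogonal => // n nM.
  apply: (hahn_norm_neq0 LP0) => // i /andP[i0 iln].
  by rewrite NM eqr_nat gtn_eqF// (leq_ltn_trans iln).
- split; first exact: krall_order_genre.
  exact: krall_eigen.
Qed.
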